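(* Let $d\ge 1$, $N=d+1$, $s\in(0,1)$ and $p>\frac ds$. For any $\Lambda>0$ there exists $R>0$ such that the following holds. Let $\Sigma=\Sigma^d=\partial\Omega$ be the smooth boundary of a compact convex body in $\mathbb{R}^{d+1}$ with $$\mathcal{W}_{s,p}(\Sigma)\le\Lambda .$$ Then for any $x_0\in\Sigma$ there exist a rotation $P\in SO(N)$ and a smooth map $f:B(0,R)\to\mathbb{R}$ with $$[\nabla f]_{C^{s-d/p}(B(0,R))}\le C(\Lambda,s,p,d),$$ such that $x_0+P(x,f(x))$ is a local parametrization of $\Sigma$, that is, $\Phi(x):=x_0+P(x,f(x))$ is a diffeomorphism as a map $B(0,R)\to\Phi(B(0,R))\subset\Sigma$. Here $C(\Lambda,s,p,d)$ is a constant depending only on $\Lambda,s,p,d$.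
   Context: For $\Sigma=\partial\Omega\subset\mathbb{R}^{d+1}$ with $\Omega$ bounded and $\Sigma$ smooth, let $n:\Sigma\to\mathbb{S}^d$ be the outward unit normal. The fractional mean curvature is $$H_{\Sigma,s}(x):=c_s\int_\Sigma\frac{\langle x-y,n(y)\rangle}{|x-y|^{d+1+s}}\,d\mathcal{H}^d(y),$$ where $c_s>0$ is a fixed normalizing constant, and the fractional Willmore energy is $$\mathcal{W}_{s,p}(\Sigma):=\int_\Sigma|H_{\Sigma,s}(x)|^p\,d\mathcal{H}^d(x).$$ $B(0,R)$ is the open ball in $\mathbb{R}^d$, $(x,f(x))\in\mathbb{R}^d\times\mathbb{R}=\mathbb{R}^{N}$, and $[g]_{C^{\sigma}(B)}=\sup_{x\ne y\in B}|g(x)-g(y)|/|x-y|^{\sigma}$ is the Hölder seminorm. *)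

(* Defs.v *)
From HB Require Import structures.
From mathcomp Require Import all_boot all_order all_algebra.
From mathcomp Require Import all_classical all_reals all_analysis.

Set Implicit Arguments.
Unset Strict Implicit.
Unset Printing Implicit Defensive.
Import Order.TTheory GRing.Theory Num.Theory.
Import numFieldNormedType.Exports.

Local Open Scope classical_set_scope.
Local Open Scope ring_scope.

(* The library's norm on 'rV[R]_n is the sup norm; it induces the usual
   topology, but every metric quantity below uses the Euclidean norm. *)
Section euclidean.
Context {R : realType} {n : nat}.
Implicit Types (x y : 'rV[R]_n) (A : set 'rV[R]_n).

Definition edot x y : R := \sum_(i < n) x 0 i * y 0 i.

Definition enorm x : R := Num.sqrt (edot x x).

Definition eball x (r : R) : set 'rV[R]_n := [set y | enorm (y - x) < r].

(* equals -oo on the empty set *)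
Definition ediam A : \bar R :=
  ereal_sup [set (enorm (x - y))%:E | x in A & y in A].

End euclidean.

Section topology.
Context {T : topologicalType}.

Definition boundary (A : set T) : set T := closure A `\` A°.

End topology.

Section smoothness.
Context {R : realType} {n : nat}.

Definition basis_vec (i : 'I_n) : 'rV[R]_n := delta_mx 0 i.

Definition grad (f : 'rV[R]_n -> R) (x : 'rV[R]_n) : 'rV[R]_n :=
  \row_(i < n) 'D_(basis_vec i) f x.

Definition iter_partial {W : normedModType R} (I : seq 'I_n)
    (f : 'rV[R]_n -> W) : 'rV[R]_n -> W :=
  foldr (fun i (g : 'rV[R]_n -> W) x => 'D_(basis_vec i) g x) f I.

(* C^oo on an open set U: all iterated partial derivatives exist and are
   continuous on U *)
Definition smooth_on {W : normedModType R} (U : set 'rV[R]_n)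
    (f : 'rV[R]_n -> W) : Prop :=
  forall (I : seq 'I_n) x, U x ->
    {for x, continuous (iter_partial I f)} /\
    forall i, derivable (iter_partial I f) x (basis_vec i).

(* smoothness on an arbitrary subset A: local smooth extendability *)
Definition smooth_subset {W : normedModType R} (A : set 'rV[R]_n)
    (f : 'rV[R]_n -> W) : Prop :=
  forall x, A x -> exists (U : set 'rV[R]_n) (g : 'rV[R]_n -> W),
    [/\ open_nbhs x U, smooth_on U g & forall y, A y -> U y -> g y = f y].

Definition convex_body (Omega : set 'rV[R]_n) : Prop :=
  [/\ compact Omega,
      convex_set (Omega : set (convex_lmodType 'rV[R]_n)) &
      Omega° !=set0].

Definition defining_function (Omega : set 'rV[R]_n) (x : 'rV[R]_n)
    (rho : 'rV[R]_n -> R) : Prop :=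
  exists U : set 'rV[R]_n,
    [/\ open_nbhs x U, smooth_on U rho,
        Omega `&` U = [set y | rho y <= 0] `&` U &
        forall y, U y -> grad rho y != 0].

Definition smooth_boundary (Omega : set 'rV[R]_n) : Prop :=
  forall x, boundary Omega x -> exists rho, defining_function Omega x rho.

(* When x is a point of a smooth boundary the set below is a singleton: the
   direction of the gradient does not depend on the defining function. *)
Definition outward_normal (Omega : set 'rV[R]_n) (x : 'rV[R]_n) : 'rV[R]_n :=
  xget 0 [set nu | exists2 rho, defining_function Omega x rho &
                     nu = (enorm (grad rho x))^-1 *: grad rho x].

End smoothness.

Section hausdorff.
Context {R : realType} {n : nat} (m : nat).
Implicit Types (A U : set 'rV[R]_n).
Local Open Scope ereal_scope.

(* volume of the unit ball of R^k, from V_(k+2) = 2 pi / (k+2) V_k *)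
Fixpoint unit_ball_volume (k : nat) : R :=
  match k with
  | 0 => 1
  | 1 => 2
  | j.+2 => 2 * pi / j.+2%:R * unit_ball_volume j
  end%R.

Definition hausdorff_gauge U : \bar R :=
  if U == set0 then 0
  else (unit_ball_volume m / 2 ^+ m)%:E * ediam U ^+ m.

Definition fine_cover (delta : R) A : set (set 'rV[R]_n)^nat :=
  [set U | (forall k, ediam (U k) <= delta%:E) /\ A `<=` \bigcup_k U k].

Definition hausdorff_pre (delta : R) A : \bar R :=
  ereal_inf [set \sum_(k <oo) hausdorff_gauge (U k) | U in fine_cover delta A].

Definition hausdorff_outer A : \bar R :=
  ereal_sup [set hausdorff_pre delta A | delta in [set e : R | (0 < e)%R]].

Lemma unit_ball_volume_ge0 k : (0 <= unit_ball_volume k)%R.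
Proof.
have [] // : (0 <= unit_ball_volume k /\ 0 <= unit_ball_volume k.+1)%R.
elim: k => [|j [V0 V1]]; first by split => /=; rewrite ?ler01 ?ler0n.
by split => //=; rewrite mulr_ge0 ?divr_ge0 ?mulr_ge0 ?pi_ge0.
Qed.

Lemma ediam_ge0 U : U !=set0 -> 0 <= ediam U.
Proof.
move=> [x Ux]; apply: ereal_sup_ubound; exists x => //; exists x => //.
by rewrite subrr /enorm /edot big1 ?sqrtr0// => i _; rewrite mxE mul0r.
Qed.

Lemma hausdorff_gauge_ge0 U : 0 <= hausdorff_gauge U.
Proof.
rewrite /hausdorff_gauge; case: eqP => // /eqP/set0P U0.
rewrite mule_ge0// ?lee_fin ?divr_ge0 ?unit_ball_volume_ge0 ?exprn_ge0//.
by rewrite expe_ge0// ediam_ge0.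
Qed.

Lemma hausdorff_gauge0 : hausdorff_gauge set0 = 0.
Proof. by rewrite /hausdorff_gauge eqxx. Qed.

Lemma hausdorff_pre_ge0 delta A : 0 <= hausdorff_pre delta A.
Proof.
apply: le_ereal_inf_tmp => _ [U _ <-].
by apply: nneseries_ge0 => k _ _; exact: hausdorff_gauge_ge0.
Qed.

Lemma le_hausdorff_pre delta :
  {homo hausdorff_pre delta : A B / A `<=` B >-> A <= B}.
Proof.
move=> A B AB; apply: ereal_inf_le_tmp => _ [U [dU BU] <-].
by exists U => //; split => //; exact: subset_trans BU.
Qed.

Lemma hausdorff_pre0 delta : hausdorff_pre delta set0 = 0.
Proof.
apply/eqP; rewrite eq_le hausdorff_pre_ge0 andbT.
apply: ereal_inf_lbound; exists (fun=> set0).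
  split => // k; rewrite /ediam (_ : [set _ | _ in _ & _ in _] = set0).
    by rewrite ereal_sup0 leNye.
  by rewrite -subset0 => z [x []].
by rewrite eseries0// => k _ _; exact: hausdorff_gauge0.
Qed.

Lemma hausdorff_pre_sigma_subadditive delta :
  sigma_subadditive (hausdorff_pre delta).
Proof.
move=> A; have [[i ioo]|] := pselect (exists i, hausdorff_pre delta (A i) = +oo).
  rewrite (eseries_pinfty _ _ ioo) ?leey// => k _.
  by rewrite -ltNye (lt_le_trans _ (hausdorff_pre_ge0 _ _)).
rewrite -forallNE => Aoo.
apply/lee_addgt0Pr => _/posnumP[e].
rewrite (le_trans _ (epsilon_trick _ _ _))//; last first.
  by move=> k; exact: hausdorff_pre_ge0.
pose P k (B : (set 'rV[R]_n)^nat) := fine_cover delta (A k) B /\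
  \sum_(j <oo) hausdorff_gauge (B j) <=
  hausdorff_pre delta (A k) + (e%:num / (2 ^ k.+1)%:R)%:E.
have [G PG] : {G : ((set 'rV[R]_n)^nat)^nat & forall k, P k (G k)}.
  apply: (@choice _ _ P) => k; rewrite /P.
  have en1 : (0 < e%:num / (2 ^ k.+1)%:R)%R by [].
  have fA : hausdorff_pre delta (A k) \is a fin_num.
    rewrite ge0_fin_numE ?hausdorff_pre_ge0// ltey.
    by apply/eqP; exact: Aoo.
  have [_ [B cB <-] /ltW] := lb_ereal_inf_adherent en1 fA.
  by exists B.
have g0 x : 0 <= (hausdorff_gauge \o uncurry G) x.
  exact: hausdorff_gauge_ge0.
apply: (@le_trans _ _ (\esum_(i in setT) (hausdorff_gauge \o uncurry G) i)).
  apply: ereal_inf_lbound => /=.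
  have /card_esym/ppcard_eqP[f] := card_nat2.
  exists (uncurry G \o f).
    split => [i|]; first by rewrite /=; case: (f i) => a b; exact: (PG a).1.1.
    apply: (@subset_trans _ (\bigcup_i \bigcup_k G i k)) => [t [i _]|].
      by move=> /((PG i).1.2) -[j _ ?]; exists i => //; exists j.
    move=> t [i _ [j _ Bijt]]; exists (f^-1%FUN (i, j)) => //=.
    by rewrite invK ?inE.
  rewrite -(esum_pred_image (hausdorff_gauge \o uncurry G) _ xpredT)
    ?[fun=> _]set_true//.
  by rewrite image_eq.
rewrite (_ : esum _ _ = \sum_(i <oo) \sum_(j <oo) hausdorff_gauge (G i j));
  last first.
  pose J : nat -> set (nat * nat) := fun i => [set (i, j) | j in setT].
  rewrite (_ : setT = \bigcup_k J k); last first.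
    by rewrite predeqE => -[a b]; split => // _; exists a => //; exists b.
  rewrite esum_bigcupT /=; last 2 first.
    - apply/trivIsetP => i j _ _ ij.
      rewrite predeqE => -[k l] /=; split => //= -[] [_] _ [<-{k} _].
      by move=> [m' _] [] /esym/eqP; rewrite (negbTE ij).
    - by [].
  rewrite -(image_id [set: nat]) -fun_true esum_pred_image//; last first.
    by move=> k _; apply: esum_ge0 => x _; exact: g0.
  apply: eq_eseriesr => /= j _.
  rewrite -(esum_pred_image (hausdorff_gauge \o uncurry G) (pair j) predT)//=;
    [|by move=> *; exact: hausdorff_gauge_ge0
     |by move=> ? ? _ _; exact: (@can_inj _ _ _ snd)].
  by congr esum; rewrite predeqE => -[a b]; split; move=> [i _ <-]; exists i.
apply: lee_nneseries => [k _ _|k _].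
  by apply: nneseries_ge0 => j _ _; exact: hausdorff_gauge_ge0.
exact: (PG k).2.
Qed.

Lemma hausdorff_outer0 : hausdorff_outer set0 = 0.
Proof.
rewrite /hausdorff_outer (_ : [set _ | _ in _] = [set 0]) ?ereal_sup1//.
apply/seteqP; split => [_ [e _ <-]|_ ->] /=; first exact: hausdorff_pre0.
by exists 1%R; [exact: ltr01|exact: hausdorff_pre0].
Qed.

Lemma hausdorff_outer_ge0 A : 0 <= hausdorff_outer A.
Proof.
apply: le_ereal_sup_tmp; exists (hausdorff_pre 1 A).
  by exists 1%R => //=; exact: ltr01.
exact: hausdorff_pre_ge0.
Qed.

Lemma le_hausdorff_outer : {homo hausdorff_outer : A B / A `<=` B >-> A <= B}.
Proof.
move=> A B AB; apply: ge_ereal_sup => _ [e e0 <-].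
apply: le_ereal_sup_tmp; exists (hausdorff_pre e B); first by exists e.
exact: le_hausdorff_pre.
Qed.

Lemma hausdorff_outer_sigma_subadditive : sigma_subadditive hausdorff_outer.
Proof.
move=> A; apply: ge_ereal_sup => _ [e e0 <-].
apply: le_trans (hausdorff_pre_sigma_subadditive e A) _.
apply: lee_nneseries => [k _ _|k _]; first exact: hausdorff_pre_ge0.
by apply: ereal_sup_ubound; exists e.
Qed.

HB.instance Definition _ := isOuterMeasure.Build R 'rV[R]_n hausdorff_outer
  hausdorff_outer0 hausdorff_outer_ge0 le_hausdorff_outer
  hausdorff_outer_sigma_subadditive.

Definition hausdorff_measure :
  set (caratheodory_type hausdorff_outer) -> \bar R := hausdorff_outer.

HB.instance Definition _ := isMeasure.Build _ _ _ hausdorff_measure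
  (@caratheodory_measure0 _ _ hausdorff_outer)
  (@caratheodory_measure_ge0 _ _ hausdorff_outer)
  (@caratheodory_measure_sigma_additive _ _ hausdorff_outer).

End hausdorff.

Arguments hausdorff_measure {R n} m _.

Section fractional_willmore.
Context {R : realType} {d : nat}.
Local Open Scope ereal_scope.

(* c is the normalizing constant c_s *)
Definition fractional_mean_curvature (c s : R) (Omega : set 'rV[R]_(d + 1))
    (x : 'rV[R]_(d + 1)) : \bar R :=
  c%:E * \int[hausdorff_measure d]_(y in boundary Omega)
    (edot (x - y) (outward_normal Omega y) /
     enorm (x - y) `^ (d%:R + 1 + s))%:E.

Definition fractional_willmore (c s p : R) (Omega : set 'rV[R]_(d + 1)) :
    \bar R :=
  \int[hausdorff_measure d]_(x in boundary Omega)
    (`|fractional_mean_curvature c s Omega x| `^ p).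

End fractional_willmore.

Section parametrization.
Context {R : realType}.

Definition holder_seminorm {n k : nat} (sigma : R) (B : set 'rV[R]_n)
    (g : 'rV[R]_n -> 'rV[R]_k) : \bar R :=
  ereal_sup [set (enorm (g z.1 - g z.2) / enorm (z.1 - z.2) `^ sigma)%:E
            | z in [set z | [/\ B z.1, B z.2 & z.1 <> z.2]]].

Definition special_orthogonal {n : nat} (P : 'M[R]_n) : Prop :=
  P *m P^T = 1%:M /\ \det P = 1.

Definition diffeo_onto_image {n k : nat} (B : set 'rV[R]_n)
    (Phi : 'rV[R]_n -> 'rV[R]_k) : Prop :=
  smooth_on B Phi /\
  exists Psi : 'rV[R]_k -> 'rV[R]_n,
    (forall x, B x -> Psi (Phi x) = x) /\ smooth_subset (Phi @` B) Psi.

(* Phi parametrizes a relatively open piece of S containing x0 *)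
Definition local_parametrization {n k : nat} (S : set 'rV[R]_k)
    (x0 : 'rV[R]_k) (B : set 'rV[R]_n) (Phi : 'rV[R]_n -> 'rV[R]_k) : Prop :=
  [/\ (Phi @` B) x0,
      exists2 U, open U & Phi @` B = S `&` U &
      diffeo_onto_image B Phi].

(* x |-> x0 + P (x, f x); the vector P v is v *m P^T in row convention *)
Definition rotated_graph {d : nat} (x0 : 'rV[R]_(d + 1)) (P : 'M[R]_(d + 1))
    (f : 'rV[R]_d -> R) (x : 'rV[R]_d) : 'rV[R]_(d + 1) :=
  x0 + row_mx x (f x)%:M *m P^T.

End parametrization.

(* Main.v *)
Require Import Defs.
From HB Require Import structures.
From mathcomp Require Import all_boot all_order all_algebra.
From mathcomp Require Import all_classical all_reals all_analysis.
From mathcomp Require Import ring lra.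

(** Put [alpha = s - d / p], which is positive, and let [n] be the outward unit
    normal along the boundary [S] of the convex body [Omega].  Everything follows
    from one estimate, valid at every scale: if [Omega] contains a ball of radius
    [r] centred at [z], then [n] varies by at most [C r^alpha] on the part of [S]
    within distance [8 r] of [z] ([normal_oscillation]).

    By convexity [<y - x, n(y)> >= 0] for [x] and [y] on [S], so the integral
    defining the fractional mean curvature dominates each of its parts.  Pieces of
    [S] of size [r] have measure at least [c r^d], since they project onto a
    [d]-dimensional cube ([hausdorff_outer_ge_cube]).  Markov's inequality, used
    once for the energy and once for the curvature, then yields a point [x_i] in
    each of finitely many prescribed pieces and a point [y] in one more piece such
    that [<y - x_i, n(y)> <= C r^(1 + alpha)] for all [i] ([energy_selection]):
    the supporting hyperplane at [y] nearly touches [S] at all the [x_i].  If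
    those pieces surround two points [w1] and [w2] of [S] in all tangential
    directions, convexity turns this into [|n(w1) - n(y)|, |n(w2) - n(y)| <=
    C r^alpha] ([normals_close]).  In this way an integral bound becomes a
    pointwise one.

    The radius of the chart is found by letting inner balls grow.  Smoothness
    provides an inner ball of some tiny radius [t] at distance at most [2 t] from
    [x0].  As long as [C t^alpha <= 1/8] the normal hardly turns at scale [t], so
    [Omega] is close to a half-space there and contains an inner ball of radius
    [3/2 t], again near [x0] ([inner_ball_growth]).  Hence every boundary point has
    inner balls of all radii up to some [rho] that depends only on [C] and
    [alpha] ([inner_ball_all_scales]).

    In the direction of [n(x0)] the boundary is then a graph over a ball of radius
    comparable to [rho].  Its gradient is the slope of [n], and the oscillation
    estimate at scale [|x - y|], around an arbitrary point of the graph, is the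
    Hoelder bound ([slope_holder]).  The graph is differentiable because its
    increments are squeezed between those of supporting hyperplanes
    ([graph_is_derive]).  It is smooth because its slope is a rational function of
    the gradient of a defining function evaluated on the graph, so that all its
    derivatives are obtained from a first-order system ([graph_smooth]). *)

Set Implicit Arguments.
Unset Strict Implicit.
Unset Printing Implicit Defensive.
Import Order.TTheory GRing.Theory Num.Theory.
Import numFieldNormedType.Exports.

Local Open Scope classical_set_scope.
Local Open Scope ring_scope.

(** * Euclidean geometry of row vectors *)

Section EuclideanSpace.
Context {R : realType} {n : nat}.
Implicit Types (x y z : 'rV[R]_n) (a b : R).

Lemma edotC x y : edot x y = edot y x.
Proof. by apply: eq_bigr => i _; rewrite mulrC. Qed.

Lemma edotDl x y z : edot (x + y) z = edot x z + edot y z.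
Proof. by rewrite -big_split; apply: eq_bigr => i _; rewrite mxE mulrDl. Qed.

Lemma edotZl a x y : edot (a *: x) y = a * edot x y.
Proof. by rewrite mulr_sumr; apply: eq_bigr => i _; rewrite mxE mulrA. Qed.

Lemma edotDr x y z : edot x (y + z) = edot x y + edot x z.
Proof. by rewrite edotC edotDl !(edotC x). Qed.

Lemma edotZr a x y : edot x (a *: y) = a * edot x y.
Proof. by rewrite edotC edotZl edotC. Qed.

Lemma edotNl x y : edot (- x) y = - edot x y.
Proof. by rewrite -scaleN1r edotZl mulN1r. Qed.

Lemma edotNr x y : edot x (- y) = - edot x y.
Proof. by rewrite edotC edotNl edotC. Qed.

Lemma edotBl x y z : edot (x - y) z = edot x z - edot y z.
Proof. by rewrite edotDl edotNl. Qed.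

Lemma edotBr x y z : edot x (y - z) = edot x y - edot x z.
Proof. by rewrite edotDr edotNr. Qed.

Lemma edot0l x : edot 0 x = 0.
Proof. by rewrite -(scale0r 0) edotZl mul0r. Qed.

Lemma edot0r x : edot x 0 = 0.
Proof. by rewrite edotC edot0l. Qed.

Definition edotE := (edotDl, edotDr, edotNl, edotNr, edotZl, edotZr).

Lemma edot_mulmx x y : edot x y = (x *m y^T) 0 0.
Proof. by rewrite mxE; apply: eq_bigr => i _; rewrite mxE. Qed.

Lemma edot_ge0 x : 0 <= edot x x.
Proof. by apply: sumr_ge0 => i _; rewrite -expr2 sqr_ge0. Qed.

Lemma enorm_ge0 x : 0 <= enorm x.
Proof. exact: sqrtr_ge0. Qed.

Lemma enorm2 x : enorm x ^+ 2 = edot x x.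
Proof. by rewrite sqr_sqrtr // edot_ge0. Qed.

Lemma edot_eq0 x : (edot x x == 0) = (x == 0).
Proof.
apply/idP/eqP => [|->]; last by rewrite edot0l.
rewrite psumr_eq0 => [/allP h|i _]; last by rewrite -expr2 sqr_ge0.
apply/rowP => i; rewrite mxE.
by have := h i (mem_index_enum i); rewrite /= mulf_eq0 orbb => /eqP.
Qed.

Lemma enorm_eq0 x : (enorm x == 0) = (x == 0).
Proof. by rewrite -(sqrf_eq0 (enorm x)) enorm2 edot_eq0. Qed.

Lemma enorm0 : enorm (0 : 'rV[R]_n) = 0.
Proof. by apply/eqP; rewrite enorm_eq0. Qed.

Lemma enormZ a x : enorm (a *: x) = `|a| * enorm x.
Proof.
by rewrite /enorm edotZl edotZr mulrA -expr2 sqrtrM ?sqr_ge0// sqrtr_sqr.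
Qed.

Lemma enormN x : enorm (- x) = enorm x.
Proof. by rewrite -scaleN1r enormZ normrN1 mul1r. Qed.

Lemma enormC x y : enorm (x - y) = enorm (y - x).
Proof. by rewrite -opprB enormN. Qed.

Lemma edot_le x y : edot x y <= enorm x * enorm y.
Proof.
have [->|x0] := eqVneq x 0; first by rewrite edot0l mulr_ge0 ?enorm_ge0.
have [->|y0] := eqVneq y 0; first by rewrite edot0r mulr_ge0 ?enorm_ge0.
have ex : 0 < enorm x by rewrite lt_def enorm_ge0 enorm_eq0 x0.
have ey : 0 < enorm y by rewrite lt_def enorm_ge0 enorm_eq0 y0.
have := edot_ge0 (enorm y *: x - enorm x *: y).
rewrite !edotE (edotC y x) -(enorm2 x) -(enorm2 y) => h.
have exy : 0 < enorm x * enorm y by rewrite mulr_gt0.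
rewrite -(ler_pM2l exy) -subr_ge0; nra.
Qed.

Lemma edot_abs_le x y : `|edot x y| <= enorm x * enorm y.
Proof.
by rewrite ler_norml edot_le andbT lerNl -edotNl -(enormN x) edot_le.
Qed.

Lemma enormD x y : enorm (x + y) <= enorm x + enorm y.
Proof.
rewrite -(@ler_pXn2r _ 2) ?nnegrE ?addr_ge0 ?enorm_ge0//.
rewrite enorm2 !edotE (edotC y x) sqrrD -!enorm2.
have := edot_le x y; lra.
Qed.

Lemma enormB x y : enorm (x - y) <= enorm x + enorm y.
Proof. by rewrite -(enormN y) enormD. Qed.

Lemma enorm_dist_trans y x z : enorm (x - z) <= enorm (x - y) + enorm (y - z).
Proof. by rewrite -[x - z](subrKA y) enormD. Qed.

Lemma coord_le_enorm x i : `|x 0 i| <= enorm x.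
Proof.
rewrite -(@ler_pXn2r _ 2) ?nnegrE ?enorm_ge0// enorm2 real_normK ?num_real//.
rewrite /edot (bigD1 i)//= -expr2 lerDl sumr_ge0// => j _.
by rewrite -expr2 sqr_ge0.
Qed.

Lemma enorm_le_sum x : enorm x <= \sum_(i < n) `|x 0 i|.
Proof.
have s0 : 0 <= \sum_(i < n) `|x 0 i| by exact: sumr_ge0.
rewrite -(@ler_pXn2r _ 2) ?nnegrE ?enorm_ge0// enorm2 expr2 mulr_suml.
apply: ler_sum => i _; apply: (le_trans (ler_norm _)); rewrite normrM.
by apply: ler_wpM2l => //; rewrite (bigD1 i)//= lerDl sumr_ge0.
Qed.

Lemma coord_le_norm x i : `|x 0 i| <= `|x|.
Proof.
by rewrite [leRHS]/Num.norm /= mx_normrE; apply/bigmax_geP; right; exists (0, i).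
Qed.

Lemma enorm_le_norm x : enorm x <= n%:R * `|x|.
Proof.
apply: (le_trans (enorm_le_sum x)).
have -> : n%:R * `|x| = \sum_(i < n) `|x|.
  by rewrite mulr_natl sumr_const card_ord.
apply: ler_sum => i _; exact: coord_le_norm.
Qed.

Lemma norm_le_enorm x : `|x| <= enorm x.
Proof.
rewrite [leLHS]/Num.norm /= mx_normrE; apply/bigmax_leP.
by split => [|[i j] _]; rewrite ?enorm_ge0//= ord1 coord_le_enorm.
Qed.

Lemma nbhs_eballP x (A : set 'rV[R]_n) :
  nbhs x A <-> exists2 e, 0 < e & eball x e `<=` A.
Proof.
split=> [/nbhs_ballP[e e0 xeA]|[e e0 xeA]].
  exists e => // y xy; apply: xeA; rewrite mx_norm_ball /ball_/= distrC.
  exact: le_lt_trans (norm_le_enorm _) xy.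
have ne : 0 < e / n.+1%:R by rewrite divr_gt0.
apply/nbhs_ballP; exists (e / n.+1%:R) => //= y.
rewrite mx_norm_ball /ball_/= distrC => xy; apply: xeA.
apply: (le_lt_trans (enorm_le_norm _)).
rewrite ltr_pdivlMr// in xy; apply: le_lt_trans xy; rewrite mulrC.
by apply: ler_wpM2l => //; rewrite ler_nat.
Qed.

Lemma eball_center x e : 0 < e -> eball x e x.
Proof. by move=> e0; rewrite /eball/= subrr enorm0. Qed.

Lemma eball_open x e : open (eball x e).
Proof.
rewrite openE => y xy; apply/nbhs_eballP.
exists (e - enorm (y - x)); first by rewrite subr_gt0.
move=> z yz; rewrite /eball/=; apply: (le_lt_trans (enorm_dist_trans y _ _)).
by rewrite -ltrBrDr.
Qed.

Lemma enorm_lipschitz x y : `|enorm x - enorm y| <= enorm (x - y).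
Proof.
have h (u v : 'rV[R]_n) : enorm u - enorm v <= enorm (u - v).
  by rewrite lerBlDr; have := enormD (u - v) v; rewrite subrK.
by rewrite ler_norml h andbT lerNl opprB enormC h.
Qed.

Lemma lipschitz_enorm_continuous (f : 'rV[R]_n -> R) k x :
  (forall y, `|f y - f x| <= k * enorm (y - x)) -> {for x, continuous f}.
Proof.
move=> fk A /nbhs_ballP[e/= e0 eA].
have k0 : 0 < `|k| + 1 by rewrite ltr_pwDr.
apply/nbhs_eballP; exists (e / (`|k| + 1)); first by rewrite divr_gt0.
move=> y; rewrite /eball/= ltr_pdivlMr// mulrC => yx; apply: eA.
rewrite /ball/= distrC (le_lt_trans (fk _))// (le_lt_trans _ yx)//.
apply: ler_wpM2r; first exact: enorm_ge0.
by rewrite (le_trans (ler_norm _))// lerDl.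
Qed.

Lemma edot_continuous y : continuous (edot^~ y).
Proof.
move=> x; apply: (@lipschitz_enorm_continuous _ (enorm y)) => z.
by rewrite -edotBl mulrC edot_abs_le.
Qed.

Lemma enorm_unit_dist x y : enorm x = 1 -> enorm y = 1 ->
  enorm (x - y) ^+ 2 = 2 * (1 - edot x y).
Proof.
move=> x1 y1; rewrite enorm2 !edotE (edotC y x) -!enorm2 x1 y1; ring.
Qed.

End EuclideanSpace.

(** * Open sets are measurable for the Hausdorff measure *)

Section MetricOuterMeasure.
Context {R : realType} {n : nat}.
Local Open Scope ereal_scope.

Definition separated (A B : set 'rV[R]_n) : Prop :=
  exists2 e : R, (0 < e)%R & forall x y, A x -> B y -> (e <= enorm (x - y))%R.

Lemma le_hausdorff_pre_delta m (d1 d2 : R) (A : set 'rV[R]_n) :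
  (d1 <= d2)%R -> hausdorff_pre m d2 A <= hausdorff_pre m d1 A.
Proof.
move=> d12; apply: ereal_inf_le_tmp => _ [U [dU AU] <-].
by exists U => //; split => // k; rewrite (le_trans (dU k))// lee_fin.
Qed.

Lemma ediam0 : ediam (set0 : set 'rV[R]_n) = -oo.
Proof.
rewrite /ediam (_ : image2 _ _ _ = set0) ?ereal_sup0//.
by rewrite -subset0 => z [x []].
Qed.

(** A set of diameter less than [e] meets at most one of [A] and [B], so that a
    fine cover of the union splits into covers of both. *)
Lemma hausdorff_pre_separated m (e delta : R) (A B : set 'rV[R]_n) :
  (delta < e)%R -> (forall x y, A x -> B y -> (e <= enorm (x - y))%R) ->
  hausdorff_pre m delta A + hausdorff_pre m delta B <=
  hausdorff_pre m delta (A `|` B).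
Proof.
move=> de ABe; apply: le_ereal_inf_tmp => _ [U [dU ABU] <-].
pose V (C : set 'rV[R]_n) k := if pselect (U k `&` C !=set0) then U k else set0.
have VC C : C `<=` A `|` B ->
    hausdorff_pre m delta C <= \sum_(k <oo) hausdorff_gauge m (V C k).
  move=> CAB; apply: ereal_inf_lbound; exists (V C) => //; split => [k|x Cx].
    by rewrite /V; case: pselect => ?; [exact: dU|rewrite ediam0 leNye].
  have [k _ Ukx] := ABU x (CAB _ Cx); exists k => //.
  by rewrite /V; case: pselect => // -[]; exists x.
have := leeD (VC A (@subsetUl _ A B)) (VC B (@subsetUr _ A B)).
move=> /le_trans; apply.
rewrite -nneseriesD; last 2 first.
  by move=> *; exact: hausdorff_gauge_ge0.
  by move=> *; exact: hausdorff_gauge_ge0.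
apply: lee_nneseries => [k _ _|k _].
  by rewrite adde_ge0// hausdorff_gauge_ge0.
rewrite /V; case: pselect => [[x [Ux Ax]]|?];
  case: pselect => [[y [Uy By]]|?];
  rewrite ?hausdorff_gauge0 ?adde0 ?add0e ?hausdorff_gauge_ge0//.
have : (enorm (x - y))%:E <= ediam (U k).
  by apply: ereal_sup_ubound; exists x => //; exists y.
move=> /le_trans /(_ (dU k)); rewrite lee_fin => /(le_trans (ABe _ _ Ax By)).
by rewrite leNgt de.
Qed.

Lemma hausdorff_outer_separated m (A B : set 'rV[R]_n) : separated A B ->
  hausdorff_outer m A + hausdorff_outer m B <= hausdorff_outer m (A `|` B).
Proof.
move=> [e e0 ABe].
set M := hausdorff_outer m (A `|` B).
have [->|Mfin] := eqVneq M +oo; first by rewrite leey.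
have fin C : C `<=` A `|` B -> hausdorff_outer m C \is a fin_num.
  move=> CAB; rewrite ge0_fin_numE ?hausdorff_outer_ge0//.
  by rewrite (le_lt_trans (le_hausdorff_outer m CAB))// ltey.
have pre (d1 d2 : R) : (0 < d1)%R -> (0 < d2)%R ->
    hausdorff_pre m d1 A + hausdorff_pre m d2 B <= M.
  move=> d10 d20; pose d : R := Num.min (Num.min d1 d2) (e / 2)%R.
  have d0 : (0 < d)%R by rewrite !lt_min d10 d20 divr_gt0.
  have de : (d < e)%R by rewrite gt_min; apply/orP; right; lra.
  apply: (@le_trans _ _ (hausdorff_pre m d A + hausdorff_pre m d B)).
    by rewrite leeD// le_hausdorff_pre_delta// /d !ge_min lexx ?orbT.
  apply: (le_trans (hausdorff_pre_separated m de ABe)).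
  by apply: ereal_sup_ubound; exists d.
have fA := fin A (@subsetUl _ A B); have fB := fin B (@subsetUr _ A B).
have fpre C (d : R) : hausdorff_outer m C \is a fin_num -> (0 < d)%R ->
    hausdorff_pre m d C \is a fin_num.
  rewrite !ge0_fin_numE ?hausdorff_pre_ge0 ?hausdorff_outer_ge0// => fC d0.
  by apply: le_lt_trans fC; apply: ereal_sup_ubound; exists d.
rewrite -leeBrDr//; apply: ge_ereal_sup => _ [d1 d10 <-].
rewrite leeBrDr// addeC -leeBrDr ?fpre//; apply: ge_ereal_sup => _ [d2 d20 <-].
by rewrite leeBrDr ?fpre// addeC pre.
Qed.

(** The layers at depth between [1/(k+2)] and [1/(k+1)] below the boundary of an
    open set are, two indices apart, at positive distance from each other;
    additivity over separated sets makes their measures summable, which is all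
    that Caratheodory's criterion needs. *)
Lemma open_caratheodory (mu : {outer_measure set 'rV[R]_n -> \bar R})
    (U : set 'rV[R]_n) :
  (forall A B, separated A B -> mu A + mu B <= mu (A `|` B)) ->
  open U -> mu.-caratheodory U.
Proof.
move=> musep oU; apply: le_caratheodory_measurable => X.
have [->|Xfin] := eqVneq (mu X) +oo; first by rewrite leey.
pose r k : R := (k.+1%:R^-1)%R.
have r0 k : (0 < r k)%R by rewrite invr_gt0.
have rS k : (r k.+1 < r k)%R by rewrite ltf_pV2 ?posrE// ltr_nat.
pose A k := [set x | X x /\ eball x (r k) `<=` U].
have AU k : A k `<=` X `&` U.
  by move=> x [Xx xU]; split => //; apply: xU; exact: eball_center.
have sep k B : B `<=` ~` A k.+1 -> B `<=` X -> separated (A k) B.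
  move=> BA BX; exists (r k - r k.+1)%R; first by rewrite subr_gt0.
  move=> x y [_ xU] By; have := BA _ By; rewrite /A /= => nAy.
  have [u yu nUu] : exists2 u, eball y (r k.+1) u & ~ U u.
    apply: contra_notP nAy => nu; split; first exact: BX.
    by move=> u yu; apply: contrapT => nUu; apply: nu; exists u.
  have xu : (r k <= enorm (u - x))%R.
    by rewrite leNgt; apply/negP => xu; exact/nUu/xU.
  rewrite lerBlDr (le_trans xu)// enormC.
  by rewrite (le_trans (enorm_dist_trans y _ _))// lerD2l enormC ltW.
have muX B : B `<=` X -> mu B <= mu X by exact: le_outer_measure.
have AX k : A k `<=` X by move=> x [].
have Amono k : A k `<=` A k.+1.
  move=> x [Xx xU]; split => // y yx; apply: xU.
  exact: lt_trans yx (rS k).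
pose D k := A k.+1 `\` A k.
have DX k : D k `<=` X by move=> x [/AX].
have Dsum k : \sum_(0 <= j < k.+1) mu (D j) <= mu (A k.+1) + mu (A k).
  elim: k => [|k ih].
    rewrite big_nat1 (le_trans (le_outer_measure mu _ _ (@subDsetl _ _ _)))//.
    by rewrite leeDl// outer_measure_ge0.
  rewrite big_nat_recr//= (le_trans (leeD2r _ ih))// -addeA [leRHS]addeC leeD2l//.
  rewrite (le_trans (musep _ _ (sep _ _ _ _)))//; first by move=> x [].
  by apply: le_outer_measure => x [/Amono/Amono|[]].
have Dfin : \sum_(0 <= j <oo) mu (D j) < +oo.
  apply: (@le_lt_trans _ _ (mu X + mu X)); last first.
    by rewrite lte_add_pinfty// ltey.
  apply: lime_le => [|].
    by apply: is_cvg_nneseries => *; exact: outer_measure_ge0.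
  near=> k; have k0 : (0 < k)%N by near: k; exists 1%N.
  by rewrite -(prednK k0) (le_trans (Dsum _))// leeD// muX.
have tail := nneseries_tail_cvg Dfin (fun k _ => outer_measure_ge0 mu (D k)).
have cover k : X `&` U `<=` A k `|` \bigcup_(j in ~` `I_k) D j.
  move=> x [Xx Ux].
  have /nbhs_eballP[e e0 xeU] : nbhs x U by exact: open_nbhs_nbhs.
  have exA : exists j, `[< A j x >].
    have [j _ je] := near_infty_natSinv_lt (PosNum e0).
    exists j; apply/asboolP; split => // y yx; apply: xeU.
    exact: lt_trans yx (je j (leqnn j)).
  case: (ex_minnP exA) => -[|j] /asboolP Ajx minj.
    by left; elim: k => // k; exact: Amono.
  have [jk|kj] := ltnP j k.
    by left; rewrite -(subnKC jk); elim: (k - j.+1)%N => [|i /Amono];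
      rewrite ?addn0 ?addnS.
  right; exists j; first by apply/negP; rewrite /= -leqNgt.
  split => // Ajx'; have := minj j (asboolT Ajx').
  by rewrite ltnn.
apply/lee_addgt0Pr => e e0.
have tail_lt : \forall k \near \oo, \sum_(k <= j <oo) mu (D j) < e%:E.
  by apply: (tail [set y | y < e%:E]); apply: (@open_ereal_lt' _ 0 e%:E).
near \oo => k.
apply: (@le_trans _ _ (mu (A k) + \sum_(k <= j <oo) mu (D j) + mu (X `&` ~` U))).
  rewrite leeD2r// (le_trans (le_outer_measure mu _ _ (cover k)))//.
  rewrite (le_trans (outer_measureU2 _ _ _))// leeD2l//.
  exact: outer_measure_sigma_subadditive_tail.
rewrite addeAC leeD//.
  have nUA : X `&` ~` U `<=` ~` A k.+1 by move=> x [_ nUx] /AU[].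
  rewrite (le_trans (musep _ _ (sep _ _ nUA (@subIsetl _ _ _))))//.
  by apply: le_outer_measure => x [/AX|[]].
by apply: ltW; near: k.
Unshelve. all: by end_near. Qed.

End MetricOuterMeasure.

(** * Lower bounds for the Hausdorff measure *)

Section CoveringACube.
Context {R : realType}.

Lemma card_arith_in_interval M (c p s e : R) : 0 < s -> s <= e ->
  #|[set g : 'I_M | `|c + s * g%:R - p| < e]%SET|%:R * s <= 3 * e.
Proof.
move=> s0 se; set S := [set g : 'I_M | _]%SET.
have [->|[g gS]] := set_0Vmem S; first by rewrite cards0; lra.
pose lo := [arg min_(i < g in S) val i].
pose hi := [arg max_(i > g in S) val i].
have [loS lomin] : lo \in S /\ forall i, i \in S -> (lo <= i)%N.
  by rewrite /lo; case: arg_minnP.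
have [hiS himax] : hi \in S /\ forall i, i \in S -> (i <= hi)%N.
  by rewrite /hi; case: arg_maxnP.
have cardS : (#|S| <= (hi - lo).+1)%N.
  rewrite -[leqRHS]card_ord.
  pose h (i : 'I_M) : 'I_(hi - lo).+1 := inord (i - lo).
  rewrite -(@card_in_imset _ _ h S) ?max_card// => i j iS jS /(congr1 val)/=.
  rewrite !inordK ?ltnS ?leq_sub2r ?himax// => ij; apply: val_inj => /=.
  by rewrite -(subnK (lomin i iS)) ij subnK// lomin.
have {}cardS : #|S|%:R * s <= ((hi - lo)%:R + 1) * s.
  by rewrite ler_wpM2r ?(ltW s0)// natr1 ler_nat.
apply: (le_trans cardS); rewrite natrB ?lomin//.
move: loS hiS; rewrite !inE !ltr_norml => /andP[h1 h2] /andP[h3 h4].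
lra.
Qed.

Lemma card_grid_in_cube d M (c p : 'rV[R]_d) (s e : R) : 0 < s -> s <= e ->
  #|[set g : {ffun 'I_d -> 'I_M} |
      [forall i, `|c 0 i + s * (g i)%:R - p 0 i| < e]]%SET|%:R * s ^+ d
  <= (3 * e) ^+ d.
Proof.
move=> s0 se.
pose F i := [set g : 'I_M | `|c 0 i + s * g%:R - p 0 i| < e]%SET.
have -> : #|[set g : {ffun 'I_d -> 'I_M} |
      [forall i, `|c 0 i + s * (g i)%:R - p 0 i| < e]]%SET| =
    #|family (fun i => mem (F i))|.
  apply: eq_card => g; rewrite inE; apply/forallP/familyP => h i;
  by have := h i; rewrite !inE.
rewrite card_family foldrE big_map big_enum/= natr_prod.
rewrite -[X in s ^+ X](card_ord d) -prodr_const -big_split/=.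
rewrite -[X in (3 * e) ^+ X](card_ord d) -prodr_const.
by apply: ler_prod => i _; rewrite (mulr_ge0 _ (ltW s0))//= card_arith_in_interval.
Qed.

(** Counting the points of a grid of mesh [s], finer than all the small cubes,
    bounds the volume of a cube by that of finitely many cubes covering it
    without any measure theory in dimension [d]; the factor [3] absorbs the
    discrepancy between the number of grid points and the volume. *)
Lemma cube_cover_volume d (a : R) (c : 'rV[R]_d) (p : nat -> 'rV[R]_d)
    (e : nat -> R) :
  0 < a -> (forall k, 0 < e k) ->
  [set x : 'rV[R]_d | forall i, `|x 0 i - c 0 i| <= a] `<=`
    \bigcup_k [set x : 'rV[R]_d | forall i, `|x 0 i - p k 0 i| < e k] ->
  exists m, a ^+ d <= 3 ^+ d * \sum_(k < m) e k ^+ d.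
Proof.
move=> a0 e0 cov.
set Q := [set x | _] in cov.
have Qc : compact Q.
  have := @rV_compact R d (fun i => `[c 0 i - a, c 0 i + a]%classic)
    (fun i => @segment_compact _ _ _).
  congr compact; apply/seteqP; split => x /= h i; have := h i.
    by rewrite in_itv/= ler_distl.
  by rewrite in_itv/= ler_distl.
have [m covm] : exists m, Q `<=`
    \bigcup_(k in `I_m) [set x : 'rV[R]_d | forall i, `|x 0 i - p k 0 i| < e k].
  move: Qc; rewrite compact_cover => /(_ nat setT) /(_ _ _ cov)[k _|D _ covD].
    rewrite (_ : [set x | _] = ball (p k) (e k)); first exact: ball_open.
    apply/seteqP; split=> [x h|x [_ h] i]; last by rewrite distrC; exact: h.
    by split=> // i j; rewrite ord1 /ball/= distrC.
  exists (\max_(i <- finmap.enum_fset D) i).+1 => x /covD[k kD xk].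
  by exists k => //=; rewrite ltnS; apply: (@leq_bigmax_seq nat _ xpredT (fun i => i)).
exists m.
have [M M0 Me] : exists2 M, (0 < M)%N & forall k, (k < m)%N -> a / M%:R <= e k.
  have ae0 k : 0 <= a / e k by rewrite divr_ge0// ltW.
  have S0 : 0 <= \sum_(k < m) a / e k by exact: sumr_ge0.
  have := archi_boundP S0; set M := Num.bound _ => SM.
  have M0 : 0 < M%:R :> R by exact: le_lt_trans SM.
  exists M; first by rewrite -(ltr0n R).
  move=> k km; rewrite ler_pdivrMr// mulrC -ler_pdivrMr// (le_trans _ (ltW SM))//.
  by rewrite (bigD1 (Ordinal km))//= lerDl sumr_ge0.
have M0' : 0 < M%:R :> R by rewrite ltr0n.
have s0 : 0 < a / M%:R by rewrite divr_gt0.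
pose S (k : 'I_m) := [set g : {ffun 'I_d -> 'I_M} |
      [forall i, `|c 0 i + (a / M%:R) * (g i)%:R - p k 0 i| < e k]]%SET.
have le_card : ((M ^ d)%N%:R : R) <= \sum_(k < m) #|S k|%:R.
  rewrite -natr_sum ler_nat.
  have <- : #|{: {ffun 'I_d -> 'I_M}}| = (M ^ d)%N by rewrite card_ffun !card_ord.
  rewrite -sum1_card.
  apply: (@leq_trans (\sum_(g : {ffun 'I_d -> 'I_M}) \sum_(k < m) (g \in S k))).
    apply: leq_sum => g _.
    have [] := covm (\row_i (c 0 i + (a / M%:R) * (g i)%:R)).
      move=> i; rewrite !mxE addrAC subrr add0r ger0_norm ?(mulr_ge0 (ltW s0))//.
      by rewrite -mulrA ger_pMr// mulrC ler_pdivrMr// mul1r ler_nat ltnW.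
    move=> k km gk; rewrite (bigD1 (Ordinal km))//= inE.
    rewrite (_ : [forall i, _] = true)//; apply/forallP => i.
    by have := gk i; rewrite mxE.
  rewrite exchange_big; apply: leq_sum => k _.
  by rewrite -sum1_card [leqRHS]big_mkcond; apply: leq_sum => g _; case: (g \in _).
have := ler_wpM2r (exprn_ge0 d (ltW s0)) le_card.
rewrite natrX -exprMn mulrC divfK ?gt_eqF// => /le_trans; apply.
rewrite mulr_suml mulr_sumr; apply: ler_sum => k _; rewrite -exprMn.
exact: card_grid_in_cube s0 (Me k (ltn_ord k)).
Qed.

End CoveringACube.

Section HausdorffLowerBound.
Context {R : realType} {n d : nat}.

Lemma unit_ball_volume_gt0 k : 0 < unit_ball_volume k :> R.
Proof.
have [] // : 0 < unit_ball_volume k :> R /\ 0 < unit_ball_volume k.+1 :> R.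
elim: k => [|j [V0 V1]]; first by split => /=; rewrite ?ltr01 ?ltr0n.
by split => //=; rewrite mulr_gt0 ?divr_gt0 ?mulr_gt0 ?pi_gt0.
Qed.

Lemma sum_half_powers m : \sum_(k < m) (2^-1 : R) ^+ k.+1 <= 1.
Proof.
suff -> : \sum_(k < m) (2^-1 : R) ^+ k.+1 = 1 - 2^-1 ^+ m.
  by rewrite gerBl exprn_ge0.
elim: m => [|m ih]; first by rewrite big_ord0 expr0 subrr.
by rewrite big_ord_recr/= ih exprS; lra.
Qed.

Lemma exprDn_le (u v : R) : 0 <= u -> 0 <= v ->
  (u + v) ^+ d <= 2 ^+ d * (u ^+ d + v ^+ d).
Proof.
move=> u0 v0; have [uv|/ltW vu] := leP u v.
  apply: (@le_trans _ _ ((2 * v) ^+ d)).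
    by apply: lerXn2r; rewrite ?nnegrE; lra.
  by rewrite exprMn ler_wpM2l ?exprn_ge0// lerDr exprn_ge0.
apply: (@le_trans _ _ ((2 * u) ^+ d)).
  by apply: lerXn2r; rewrite ?nnegrE; lra.
by rewrite exprMn ler_wpM2l ?exprn_ge0// lerDl exprn_ge0.
Qed.

(** The normalization of the Hausdorff gauge, divided by [6 ^+ d]: a factor [3]
    is lost in counting grid points and a factor [2] in enlarging the sets of a
    cover to open cubes. *)
Definition cube_constant : R := unit_ball_volume d / 2 ^+ d / 6 ^+ d.

Lemma cube_constant_gt0 : 0 < cube_constant.
Proof. by rewrite !divr_gt0 ?unit_ball_volume_gt0 ?exprn_gt0. Qed.

(** The images of the sets of a cover of [A], of diameters [D k], lie in cubes
    of half-side [D k], which are enlarged to open cubes covering the given one;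
    [cube_cover_volume] applies to these. *)
Lemma hausdorff_outer_ge_cube (A : set 'rV[R]_n) (f : 'rV[R]_n -> 'rV[R]_d)
    (c : 'rV[R]_d) (a : R) :
  (0 < d)%N -> 0 < a ->
  (forall x y i, `|f x 0 i - f y 0 i| <= enorm (x - y)) ->
  [set t : 'rV[R]_d | forall i, `|t 0 i - c 0 i| <= a] `<=` f @` A ->
  ((cube_constant * a ^+ d)%:E <= hausdorff_outer d A)%E.
Proof.
move=> d0 a0 flip QA.
apply: (@le_trans _ _ (hausdorff_pre d 1 A)); last first.
  by apply: ereal_sup_ubound; exists 1 => //=; exact: ltr01.
apply: le_ereal_inf_tmp => _ [U [dU AU] <-].
have u_ k : exists u, U k !=set0 -> U k u.
  by have [[u Uu]|h] := pselect (U k !=set0); [exists u|exists 0].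
have [u uU] := choice u_.
pose D k : R := if pselect (U k !=set0) then fine (ediam (U k)) else 0.
have D0 k : 0 <= D k.
  by rewrite /D; case: pselect => // h; rewrite fine_ge0// ediam_ge0.
have gD k : ((unit_ball_volume d / 2 ^+ d * D k ^+ d)%:E
             <= hausdorff_gauge d (U k))%E.
  rewrite /D /hausdorff_gauge; case: pselect => h; last first.
    by rewrite expr0n gtn_eqF//= mulr0 hausdorff_gauge_ge0.
  have /negbTE-> : U k != set0 by apply/set0P.
  rewrite EFinM lee_pmul2l ?lte_fin ?divr_gt0 ?unit_ball_volume_gt0 ?exprn_gt0//.
  rewrite EFin_expe fineK// ge0_fin_numE ?ediam_ge0//.
  by rewrite (le_lt_trans (dU k))// ltry.
have UD k x : U k x -> enorm (x - u k) <= D k.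
  move=> Ux; have Uk : U k !=set0 by exists x.
  rewrite /D; case: pselect => [{}Uk|/(_ Uk)//].
  rewrite -lee_fin fineK; last first.
    by rewrite ge0_fin_numE ?ediam_ge0// (le_lt_trans (dU k))// ltry.
  by apply: ereal_sup_ubound; exists x => //; exists (u k) => //; exact: uU.
set S := (\sum_(k <oo) _)%E.
have S0 : (0 <= S)%E by apply: nneseries_ge0 => *; exact: hausdorff_gauge_ge0.
have [->|Sfin] := eqVneq S +oo%E; first by rewrite leey.
have fS : S \is a fin_num by rewrite ge0_fin_numE// ltey.
rewrite -(fineK fS) lee_fin; set s := fine S.
set w := unit_ball_volume d / 2 ^+ d in gD.
have w0 : 0 < w by rewrite divr_gt0 ?unit_ball_volume_gt0 ?exprn_gt0.
have key (e : R) : 0 < e -> e <= 1 -> w * a ^+ d <= 6 ^+ d * (s + w * e).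
  move=> e0 e1.
  pose ek k := D k + e * 2^-1 ^+ k.+1.
  have ek0 k : 0 < e * 2^-1 ^+ k.+1 by rewrite mulr_gt0// exprn_gt0.
  have [|m am] := @cube_cover_volume R d a c (f \o u) ek a0 (fun k =>
    ltr_wpDl (D0 k) (ek0 k)).
    move=> t /QA[x /AU[k _ Ukx] <-]; exists k => // i /=.
    rewrite (le_lt_trans (flip _ _ _))// (le_lt_trans (UD _ _ Ukx))//.
    by rewrite ltrDl.
  have sumD : w * \sum_(k < m) D k ^+ d <= s.
    rewrite -lee_fin fineK// mulr_sumr -sumEFin.
    rewrite (le_trans (lee_sum _ (fun k _ => gD (nat_of_ord k))))//.
    rewrite -(big_mkord xpredT (fun k => hausdorff_gauge d (U k))).
    by apply: nneseries_lim_ge => *; exact: hausdorff_gauge_ge0.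
  have sume : \sum_(k < m) ek k ^+ d <= 2 ^+ d * (\sum_(k < m) D k ^+ d + e).
    rewrite mulrDr mulr_sumr.
    apply: (@le_trans _ _ (\sum_(k < m) (2 ^+ d * D k ^+ d +
        2 ^+ d * (e * 2^-1 ^+ k.+1)))).
      apply: ler_sum => k _; rewrite -mulrDr.
      rewrite (le_trans (exprDn_le (D0 k) (ltW (ek0 k))))//.
      rewrite ler_wpM2l ?exprn_ge0// lerD2l.
      rewrite -[leRHS]expr1 (ler_wiXn2l (ltW (ek0 k)))//.
      by rewrite mulr_ile1 ?(ltW e0) ?exprn_ge0 ?exprn_ile1// invf_le1 ?ler1n.
    rewrite big_split/= lerD2l -mulr_sumr -mulr_sumr ler_wpM2l ?exprn_ge0//.
    by rewrite -[leRHS]mulr1 (ler_wpM2l (ltW e0))// sum_half_powers.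
  rewrite (_ : 6 = 3 * 2)%R; last by rewrite -natrM.
  rewrite exprMn -[leRHS]mulrA (le_trans (ler_wpM2l (ltW w0) am))//.
  rewrite mulrCA ler_wpM2l ?exprn_ge0//.
  rewrite (le_trans (ler_wpM2l (ltW w0) sume))//.
  by rewrite mulrCA ler_wpM2l ?exprn_ge0// mulrDr lerD2r.
rewrite /cube_constant -/w mulrAC ler_pdivrMr ?exprn_gt0// [leRHS]mulrC.
have p6 : 0 < 6 ^+ d :> R by rewrite exprn_gt0.
apply/ler_addgt0Pr => e e0.
pose e' := Num.min 1 (e / (6 ^+ d * w)).
have e'0 : 0 < e' by rewrite lt_min ltr01 divr_gt0// mulr_gt0.
rewrite (le_trans (key e' e'0 _))//; first by rewrite ge_min lexx.
rewrite mulrDr lerD2l mulrA mulrC -ler_pdivlMr ?(mulr_gt0 p6 w0)//.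
by rewrite ge_min lexx orbT.
Qed.

End HausdorffLowerBound.

(** * Points selected by the energy *)

Section LowerIntegral.
Context d (T : measurableType d) (R : realType).
Context (mu : {measure set T -> \bar R}).
Local Open Scope ereal_scope.

(** For functions that are not known to be measurable the integral is a lower
    integral, a supremum over simple functions, and Markov's inequality still
    holds on measurable sets. *)
Lemma lower_integral_markov (D E : set T) (f : T -> \bar R) (t : R) :
  (0 <= t)%R -> measurable E -> E `<=` D -> (forall x, D x -> 0 <= f x) ->
  (forall x, E x -> t%:E <= f x) -> t%:E * mu E <= \int[mu]_(x in D) f x.
Proof.
move=> t0 mE ED f0 tf; rewrite -integral_cst//.
rewrite !ge0_integralE//.
apply/ge_ereal_sup => /= _ -[h /= hE <-]; apply: ereal_sup_ubound.
exists h => //= x.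
apply: (le_trans (hE x)); rewrite /patch; case: ifPn => [/set_mem Ex|_].
  by rewrite mem_set ?tf//; exact: ED.
by case: ifPn => // /set_mem /f0.
Qed.

End LowerIntegral.

Lemma outer_measure_le_sum (R : realType) (T : Type) (I : finType)
    (mu : {outer_measure set T -> \bar R}) (A : set T) (E : I -> set T) :
  (forall x, A x -> exists i, E i x) -> (mu A <= \sum_i mu (E i))%E.
Proof.
move=> AE; apply: (@le_trans _ _ (mu (\big[setU/set0]_i E i))).
  apply: le_outer_measure => x /AE[i Eix].
  by rewrite (bigD1 i)//=; left.
elim/big_rec2: _ => [|i m B _ mB]; first by rewrite outer_measure0.
by rewrite (le_trans (outer_measureU2 _ _ _))// leeD2l.
Qed.

Lemma edot_gt_perturb (R : realType) n (x y u : 'rV[R]_n) (t : R) :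
  t < edot (y - x) u -> exists r e : R, [/\ 0 < r, 0 < e &
    forall z w, enorm (z - y) < r -> enorm (w - u) < e -> t < edot (z - x) w].
Proof.
set g := edot (y - x) u - t => ty.
have g0 : 0 < g by rewrite subr_gt0.
have a0 := enorm_ge0 (y - x); have b0 := enorm_ge0 u.
have a1 : 0 < 4 * (enorm (y - x) + 1) by lra.
have b1 : 0 < 4 * (enorm u + 1) by lra.
exists (Num.min 1 (g / (4 * (enorm u + 1)))), (g / (4 * (enorm (y - x) + 1))).
split; [|exact: divr_gt0|move=> z w].
  by rewrite lt_min ltr01; exact: divr_gt0.
rewrite lt_min (ltr_pdivlMr _ _ a1) (ltr_pdivlMr _ _ b1) => /andP[z1 zb] nz.
have zE : edot (z - x) w = edot (y - x) u + edot (z - y) u + edot (z - x) (w - u).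
  by rewrite !edotE; ring.
have := edot_abs_le (z - y) u; rewrite ler_norml => /andP[h1 _].
have := edot_abs_le (z - x) (w - u); rewrite ler_norml => /andP[h2 _].
have h3 := enorm_dist_trans y z x.
have h4 := enorm_ge0 (z - y); have h5 := enorm_ge0 (w - u).
have h6 : enorm (z - x) * enorm (w - u) <=
    (enorm (y - x) + 1) * enorm (w - u) by apply: ler_wpM2r => //; lra.
rewrite zE; rewrite /g in g0 nz zb; lra.
Qed.

Section EnergySelection.
Context {R : realType} {d : nat}.
Variables (Omega : set 'rV[R]_(d + 1)).
Let S := boundary Omega.
Let nrm := outward_normal Omega.
Let mu := @hausdorff_outer R (d + 1) d.

Hypothesis supporting : forall x y, S x -> S y -> edot (x - y) (nrm y) <= 0.
Hypothesis continuous_normal : forall y, S y -> forall e, 0 < e ->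
  exists2 r, 0 < r & forall z, S z -> eball y r z -> enorm (nrm z - nrm y) < e.

Lemma caratheodory_open (U : set 'rV[R]_(d + 1)) :
  open U -> mu.-caratheodory U.
Proof. by apply: open_caratheodory => A B; exact: hausdorff_outer_separated. Qed.

Lemma caratheodory_boundary : mu.-caratheodory S.
Proof.
rewrite /S /boundary setDE; apply: caratheodory_measurable_setI.
  rewrite -[closure _]setCK; apply: caratheodory_measurable_setC.
  by apply: caratheodory_open; apply: closed_openC; exact: closed_closure.
by apply/caratheodory_measurable_setC/caratheodory_open; exact: open_interior.
Qed.

(** These sets are relatively open in the boundary because the normal is
    continuous.  Their measurability is what allows a union bound, as lower
    integrals are only superadditive. *)
Lemma caratheodory_tilted (x : 'rV[R]_(d + 1)) (t : R) :
  mu.-caratheodory [set y | S y /\ t < edot (y - x) (nrm y)].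
Proof.
set E := [set y | _].
pose V := [set y | exists2 r, 0 < r & forall z, S z -> eball y r z -> E z].
have -> : E = S `&` V°.
  apply/seteqP; split => [y [Sy ty]|y [Sy /interior_subset[r r0]]]; last first.
    by apply => //; exact: eball_center.
  split => //.
  have [r r0 Er] : V y.
    have [r1 [e [r10 e0 pert]]] := edot_gt_perturb ty.
    have [r r0 nr] := continuous_normal Sy e0.
    exists (Num.min r r1); first by rewrite lt_min r0 r10.
    move=> z Sz zr1.
    have /andP[zr z1] : (enorm (z - y) < r) && (enorm (z - y) < r1).
      by rewrite -lt_min.
    by split; [exact: Sz|exact: (pert z (nrm z) z1 (nr z Sz zr))].
  apply/nbhs_eballP; exists (r / 2); first by rewrite divr_gt0.
  move=> z yz; exists (r / 2); first by rewrite divr_gt0.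
  move=> w Sw zw; apply: Er => //; rewrite /eball/=.
  move: yz zw; rewrite /eball/=; have := enorm_dist_trans z w y; lra.
apply: caratheodory_measurable_setI; first exact: caratheodory_boundary.
by apply: caratheodory_open; exact: open_interior.
Qed.

(** Markov's inequality for the energy gives in each [Q i] a point [x i] whose
    curvature is at most [(2 Lambda / m) `^ p^-1].  Markov's inequality for the
    integral defining that curvature shows that the points [y] of [Q0] violating
    the conclusion for a given [i] have measure at most [m / (#|I| + 1)], so
    that some [y] violates none of them. *)
Lemma energy_selection (c s p Lambda m L : R) (I : finType)
    (Q : I -> set 'rV[R]_(d + 1)) (Q0 : set 'rV[R]_(d + 1)) :
  0 < c -> 0 <= s -> 0 < p -> 0 < Lambda -> 0 < m -> 0 < L ->
  (fractional_willmore c s p Omega <= Lambda%:E)%E ->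
  (forall i, Q i `<=` S) -> Q0 `<=` S ->
  (forall i, mu.-caratheodory (Q i)) -> mu.-caratheodory Q0 ->
  (forall i, (m%:E <= mu (Q i))%E) -> (m%:E <= mu Q0)%E ->
  (forall i x y, Q i x -> Q0 y -> enorm (x - y) <= L) ->
  exists (x : I -> 'rV[R]_(d + 1)) (y : 'rV[R]_(d + 1)),
    [/\ forall i, Q i (x i), Q0 y & forall i, edot (y - x i) (nrm y) <=
      L `^ (d%:R + 1 + s) *
        ((2 * Lambda / m) `^ p^-1 / (c * m) * (#|I|%:R + 1))].
Proof.
move=> c0 s0 p0 Lam0 m0 L0 W QS Q0S mQ mQ0 Qm Q0m QL.
set q := d%:R + 1 + s; set h := (2 * Lambda / m) `^ p^-1.
set M := L `^ q * _.
pose v x y := edot (y - x) (nrm y) / enorm (x - y) `^ q.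
have v0 x y : S x -> S y -> 0 <= v x y.
  move=> Sx Sy; rewrite divr_ge0 ?powR_ge0//.
  by have := supporting Sx Sy; rewrite !edotBl; lra.
have HE x : S x -> (`|fractional_mean_curvature c s Omega x|
    = c%:E * \int[hausdorff_measure d]_(y in S) (v x y)%:E)%E.
  move=> Sx; rewrite /fractional_mean_curvature abseM gee0_abs ?lee_fin ?(ltW c0)//.
  congr (_ * _)%E.
  rewrite (_ : (fun y => _) = (fun y => - (v x y)%:E)%E); last first.
    apply/funext => y; rewrite -EFinN /v -mulNr -edotNl opprB.
    by [].
  rewrite integral_ge0N; last by move=> y Sy; rewrite lee_fin v0.
  rewrite abseN gee0_abs//; apply: integral_ge0 => y Sy.
  by rewrite lee_fin v0.
have hp : h `^ p = 2 * Lambda / m.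
  rewrite /h -powRrM mulVf ?gt_eqF// powRr1// divr_ge0 ?(ltW m0)//.
  by rewrite mulr_ge0 ?(ltW Lam0).
have h0 : 0 < h by rewrite powR_gt0// divr_gt0// mulr_gt0.
have good i : exists x, Q i x /\
    (\int[hausdorff_measure d]_(y in S) (v x y)%:E <= (h / c)%:E)%E.
  apply: contrapT => /forallNP bad.
  suff : ((2 * Lambda)%:E <= Lambda%:E)%E by rewrite lee_fin; lra.
  apply: le_trans W.
  have markov := @lower_integral_markov _ _ _ (@hausdorff_measure R (d + 1) d) S (Q i)
    (fun x => `|fractional_mean_curvature c s Omega x| `^ p)%E (h `^ p)
    (powR_ge0 _ _) (mQ i) (QS i) (fun x _ => poweR_ge0 _ _).
  apply: (le_trans _ (markov _)) => [|x Qx]; last first.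
    rewrite -poweR_EFin gt0_ler_poweR ?(ltW p0)// ?in_itv/= ?leey ?lee_fin//.
    - by rewrite (ltW h0).
    - by rewrite abse_ge0.
    - rewrite leNgt; apply/negP => Hh; apply: (bad x); split => //.
      move: Hh; rewrite HE; last exact: QS Qx.
      by move=> /ltW ?; rewrite EFinM muleC lee_pdivlMl.
  rewrite hp -[X in (X%:E <= _)%E](@divfK _ m)
    ?gt_eqF// EFinM lee_pmul2l//.
  by rewrite lte_fin divr_gt0// mulr_gt0.
have [x xP] := choice good.
have N1 : 0 < #|I|%:R + 1 :> R by rewrite ltr_wpDl.
set A := h / (c * m) * (#|I|%:R + 1) in M *.
have A0 : 0 < A by rewrite mulr_gt0// divr_gt0// mulr_gt0.
have M0 : 0 < M by rewrite mulr_gt0 ?powR_gt0.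
have q0 : 0 <= q by rewrite !addr_ge0.
exists x.
apply: contrapT => /forallNP bad.
pose E i := Q0 `&` [set y | S y /\ M < edot (y - x i) (nrm y)].
have Q0E y : Q0 y -> exists i, E i y.
  move=> Qy; apply: contrapT => /forallNP nE; apply: (bad y); split=> //.
    by move=> i; exact: (xP i).1.
  by move=> i; rewrite leNgt; apply/negP => h1; apply: (nE i); split => //; split => //; exact: Q0S.
have := outer_measure_le_sum mu Q0E.
have muE i : (mu (E i) <= (m / (#|I|%:R + 1))%:E)%E.
  have -> : m / (#|I|%:R + 1) = A^-1 * (h / c).
    by rewrite /A; field; rewrite !gt_eqF.
  rewrite EFinM lee_pdivlMl//; apply: le_trans (xP i).2.
  apply: (@lower_integral_markov _ _ _ (@hausdorff_measure R (d + 1) d) S).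
  - exact: ltW.
  - apply: caratheodory_measurable_setI; first exact: mQ0.
    exact: caratheodory_tilted.
  - by move=> y [/Q0S].
  - by move=> y Sy; rewrite lee_fin v0//; apply: QS (xP i).1.
  - move=> y [Qy [Sy My]]; rewrite lee_fin.
    have xy0 : 0 < enorm (x i - y).
      rewrite lt_def enorm_ge0 andbT enorm_eq0; apply/eqP => xy.
      by move: My; rewrite -opprB xy oppr0 edot0l ltNge (ltW M0).
    rewrite ler_pdivlMr ?powR_gt0// (le_trans _ (ltW My))// /M mulrC.
    rewrite (ler_wpM2r (ltW A0))// ge0_ler_powR// ?nnegrE ?(ltW L0) ?enorm_ge0//.
    exact: QL (xP i).1 Qy.
move=> /(le_trans Q0m) /le_trans /(_ (lee_sum _ (fun i _ => muE i))).
rewrite sumEFin sumr_const lee_fin -[leRHS]mulr_natr -mulrA.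
rewrite -[leLHS]mulr1 (ler_pM2l m0) mulrC ler_pdivlMr// mul1r.
lra.
Qed.

End EnergySelection.

(** * Functions with continuous partial derivatives *)

Section SmoothFunctions.
Context {R : realType} {n : nat}.

Definition edotr (y x : 'rV[R]_n) : R := edot x y.

Lemma edotr_is_linear y : linear (edotr y).
Proof. by move=> a u v; rewrite /edotr edotDl edotZl. Qed.

HB.instance Definition _ y :=
  GRing.isLinear.Build R 'rV[R]_n R *%R (edotr y) (edotr_is_linear y).

Lemma growth_along_line (W : normedModType R) (f : 'rV[R]_n -> W)
    (y v : 'rV[R]_n) (t : R) :
  derivable f (t *: v + y) v ->
  is_derive t 1 (fun h : R => f (h *: v + y)) ('D_v f (t *: v + y)).
Proof.
set g1 := fun h : R => f (h *: v + y) => df.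
have E : (fun h => h^-1 *: ((g1 \o shift t) (h *: 1) - g1 t)) =
    (fun h => h^-1 *: ((f \o shift (t *: v + y)) (h *: v) - f (t *: v + y))).
  apply/funext => h; rewrite /g1 /=; congr (_ *: (f _ - _)).
  by rewrite [h%:A]mulr1 scalerDl addrA.
by apply: DeriveDef; rewrite /derivable /derive E.
Qed.

Lemma partial_increment (f : 'rV[R]_n -> R) (y v : 'rV[R]_n) (b L e : R) :
  (forall t, Num.min 0 b <= t <= Num.max 0 b ->
     derivable f (t *: v + y) v /\ `|'D_v f (t *: v + y) - L| <= e) ->
  `|f (b *: v + y) - f y - b * L| <= e * `|b|.
Proof.
move=> Df; pose g h := f (h *: v + y); pose dg h := 'D_v f (h *: v + y).
have gD t : Num.min 0 b <= t <= Num.max 0 b -> is_derive t 1 g (dg t).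
  by move=> /Df[ft _]; exact: growth_along_line.
have gC t : Num.min 0 b <= t <= Num.max 0 b -> {for t, continuous g}.
  move=> /gD gt; apply: differentiable_continuous.
  by apply/derivable1_diffP; exact: ex_derive.
have mM : Num.min 0 b <= Num.max 0 b by rewrite ge_min le_max lexx.
have [||xi xiI] := @MVT_segment _ g dg (Num.min 0 b) (Num.max 0 b) mM.
- by move=> x; rewrite in_itv/= => /andP[h1 h2]; apply: gD; rewrite !ltW.
- apply: continuous_in_subspaceT => x; rewrite inE/= in_itv/=.
  exact: gC.
rewrite in_itv/= in xiI; have [_ le] := Df _ xiI.
have g0 : g 0 = f y by rewrite /g scale0r add0r.
rewrite -/(g b) -g0 => gE.
have -> : g b - g 0 - b * L = b * (dg xi - L).
  by move: gE; case: (leP 0 b) => _; lra.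
by rewrite normrM mulrC ler_wpM2r.
Qed.

Definition truncated (m : nat) (v : 'rV[R]_n) : 'rV[R]_n :=
  \row_i (if (i < m)%N then v 0 i else 0).

Lemma truncatedS (m : nat) (mn : (m < n)%N) v :
  truncated m.+1 v = v 0 (Ordinal mn) *: basis_vec (Ordinal mn) + truncated m v.
Proof.
apply/rowP => i; rewrite !mxE eqxx /= ltnS leq_eqVlt.
have [->|im] := eqVneq i (Ordinal mn); first by rewrite /= eqxx ltnn mulr1 addr0.
rewrite mulr0 add0r; case: eqP => // imv.
by case/eqP: im; apply: val_inj.
Qed.

Lemma truncated_le m v (t : R) (mn : (m < n)%N) :
  `|t| <= `|v| -> `|t *: basis_vec (Ordinal mn) + truncated m v| <= `|v|.
Proof.
move=> tv; rewrite [leLHS]/Num.norm/= mx_normrE; apply/bigmax_leP.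
split=> [//|[i j] _]; rewrite ord1 !mxE eqxx/=.
have [->|jm] := eqVneq j (Ordinal mn); first by rewrite ltnn addr0 mulr1.
by rewrite mulr0 add0r; case: ifP; rewrite ?normr0// => _; exact: coord_le_norm.
Qed.

(** The coordinates of [v] are added one at a time, with the mean value theorem
    for each of them. *)
Lemma partial_increments (f : 'rV[R]_n -> R) (x : 'rV[R]_n) (r e : R) :
  (forall y i, `|y| <= r -> derivable f (y + x) (basis_vec i) /\
     `|'D_(basis_vec i) f (y + x) - 'D_(basis_vec i) f x| <= e) ->
  forall v, `|v| <= r -> `|f (v + x) - f x - edot v (grad f x)| <= n%:R * e * `|v|.
Proof.
move=> Df v vr.
have main m : (m <= n)%N ->
    `|f (truncated m v + x) - f x - edot (truncated m v) (grad f x)|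
      <= m%:R * e * `|v|.
  elim: m => [_|m ih mn].
    rewrite (_ : truncated 0 v = 0); last by apply/rowP => i; rewrite !mxE.
    by rewrite add0r edot0l subrr subr0 normr0 mul0r.
  rewrite truncatedS; set b := v 0 _; set k := Ordinal mn.
  have incr := @partial_increment f (truncated m v + x) (basis_vec k) b
    ('D_(basis_vec k) f x) e.
  rewrite edotDl edotZl.
  have -> : edot (basis_vec k) (grad f x) = 'D_(basis_vec k) f x.
    rewrite /edot (bigD1 k)//= !mxE !eqxx mul1r big1 ?addr0// => i ik.
    by rewrite !mxE (negbTE ik) andbF mul0r.
  have bv : `|b| <= `|v| by exact: coord_le_norm.
  have {}incr : `|f (b *: basis_vec k + (truncated m v + x)) -
      f (truncated m v + x) - b * 'D_(basis_vec k) f x| <= e * `|b|.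
    apply: incr => t tb; rewrite addrA; apply: Df.
    rewrite (le_trans (truncated_le _ _))//; apply: le_trans bv.
    by move: tb; case: (leP 0 b) => b0 /andP[t1 t2];
      rewrite ?(ger0_norm b0) ?(ltr0_norm b0) ler_norml; lra.
  have e0 : 0 <= e.
    have r0 : `|0 : 'rV[R]_n| <= r by rewrite normr0 (le_trans _ vr).
    by have [_] := Df 0 k r0; apply: le_trans.
  have ebv : e * `|b| <= e * `|v| by apply: ler_wpM2l.
  have := ler_normD (f (truncated m v + x) - f x - edot (truncated m v) (grad f x))
    (f (b *: basis_vec k + (truncated m v + x)) -
      f (truncated m v + x) - b * 'D_(basis_vec k) f x).
  have -> : forall (p q u w z : R), p - q - u + (w - p - z) = w - q - (z + u).
    by move=> *; ring.
  rewrite !addrA in incr *; move: (ih (ltnW mn)); rewrite -natr1; lra.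
have := main n (leqnn n); rewrite (_ : truncated n v = v)//.
by apply/rowP => i; rewrite !mxE ltn_ord.
Qed.

Lemma continuous_partials_differentiable (f : 'rV[R]_n -> R) x U :
  open_nbhs x U ->
  (forall y i, U y -> derivable f y (basis_vec i)) ->
  (forall i, {for x, continuous ('D_(basis_vec i) f)}) ->
  differentiable f x /\ forall v, 'D_v f x = edot v (grad f x).
Proof.
move=> [oU Ux] fU Dfc.
have dfc : continuous (edotr (grad f x)) by move=> v; exact: edot_continuous.
have E : f \o shift x = cst (f x) + edotr (grad f x) +o_ (0 : 'rV[R]_n) id.
  apply/eqaddoP => e e0.
  pose e' := e / (n%:R + 1).
  have n1 : 0 < n%:R + 1 :> R by rewrite ltr_wpDl.
  have e'0 : 0 < e' by rewrite divr_gt0.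
  have : \forall y \near x, U y /\ forall i,
     `|'D_(basis_vec i) f y - 'D_(basis_vec i) f x| <= e'.
    have near_partials : \forall y \near x, forall i,
        `|'D_(basis_vec i) f y - 'D_(basis_vec i) f x| <= e'.
      apply: (@filter_forall _ _ (fun i y =>
        `|'D_(basis_vec i) f y - 'D_(basis_vec i) f x| <= e') (nbhs x)) => i.
      have near_i := Dfc i _ (nbhsx_ballx ('D_(basis_vec i) f x) _ e'0).
      apply: (@filterS _ (nbhs x) _ _ _ _ near_i) => y /ltW.
      by rewrite /= distrC.
    exact: (filterI (open_nbhs_nbhs (conj oU Ux)) near_partials).
  move=> /nbhs_ballP[r /= r0 xr].
  apply/nbhs_ballP; exists (r / 2); first by rewrite /= divr_gt0.
  move=> v; rewrite mx_norm_ball /ball_/= sub0r normrN => vr.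
  have est := @partial_increments f x (r / 2) e' _ v (ltW vr).
  have {}est : `|f (v + x) - f x - edot v (grad f x)| <= n%:R * e' * `|v|.
    apply: est => y i yr; have [] := xr (y + x).
      rewrite mx_norm_ball /ball_/= opprD addrC subrK normrN; lra.
    by move=> Uy; split; [exact: fU|].
  apply: (@le_trans _ _ (n%:R * e' * `|v|)).
    by move: est; congr (`|_| <= _); rewrite /= /edotr /shift/= opprD addrA.
  rewrite ler_wpM2r// /e' mulrA ler_pdivrMr// mulrC ler_wpM2l ?(ltW e0)//.
  by rewrite lerDl.
have dE := diff_unique dfc E.
have dif : differentiable f x by apply/diff_locallyP; rewrite dE.
by split=> // v; rewrite deriveE// dE.
Qed.

Lemma smooth_differentiable (f : 'rV[R]_n -> R) U x :
  open U -> smooth_on U f -> U x ->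
  differentiable f x /\ forall v, 'D_v f x = edot v (grad f x).
Proof.
move=> oU sf Ux; apply: (@continuous_partials_differentiable _ _ U) => //.
  by move=> y i Uy; have [_ /(_ i)] := sf [::] y Uy.
by move=> i; have [] := sf [:: i] x Ux.
Qed.

Lemma smooth_continuous (W : normedModType R) (f : 'rV[R]_n -> W) U x :
  smooth_on U f -> U x -> {for x, continuous f}.
Proof. by move=> sf /(sf [::])[]. Qed.

Lemma smooth_partial (W : normedModType R) (f : 'rV[R]_n -> W) U i :
  smooth_on U f -> smooth_on U ('D_(basis_vec i) f).
Proof.
move=> sf I x Ux; have := sf (rcons I i) x Ux.
by rewrite /iter_partial foldr_rcons.
Qed.

Lemma smooth_on_local (W : normedModType R) (f : 'rV[R]_n -> W) (U : set _) :
  (forall x, U x -> exists2 V : set _, V x & smooth_on V f) -> smooth_on U f.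
Proof. by move=> loc I x Ux; have [V Vx sf] := loc x Ux; exact: sf. Qed.

(** Smoothness by coinduction: it suffices to find a family of functions, each
    continuous and partially derivable, that is stable under partial derivatives
    up to equality on the open set. *)
Lemma smooth_coind (W : normedModType R) (U : set 'rV[R]_n)
    (F : ('rV[R]_n -> W) -> Prop) :
  open U ->
  (forall f, F f -> forall x, U x -> {for x, continuous f}) ->
  (forall f, F f -> forall i, exists2 g, F g &
     forall x, U x -> is_derive x (basis_vec i) f (g x)) ->
  forall f, F f -> smooth_on U f.
Proof.
move=> oU Fc Fd f Ff.
have near_eq (g h : 'rV[R]_n -> W) x : U x -> {in U, g =1 h} ->
    \forall y \near x, h y = g y.
  move=> Ux gh; have nU : nbhs x U by exact: open_nbhs_nbhs.
  by apply: (@filterS _ (nbhs x) _ _ _ _ nU) => y Uy; rewrite gh ?inE.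
have iterE I : exists2 g, F g & {in U, iter_partial I f =1 g}.
  elim: I => [|i I [g Fg IE]]; first by exists f.
  have [h Fh gh] := Fd g Fg i; exists h => // x; rewrite inE => Ux.
  have dg := gh x Ux.
  rewrite /= -[RHS](@derive_val _ _ _ _ _ _ _ dg); apply: near_eq_derive.
  by apply: near_eq => // y yU; rewrite IE.
move=> I x Ux; have [g Fg IE] := iterE I.
have gI := near_eq _ _ x Ux IE; split.
  rewrite /prop_for /continuous_at IE ?inE//.
  exact: cvg_trans (near_eq_cvg gI) (Fc g Fg x Ux).
move=> i; have [h Fh gh] := Fd g Fg i.
by apply: near_eq_derivable gI _; apply: ex_derive; exact: gh.
Qed.

End SmoothFunctions.

Section AffineSmooth.
Context {R : realType} {n k : nat}.
Implicit Types (M : 'M[R]_(n, k)) (h : 'rV[R]_n -> R) (u w : 'rV[R]_k).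

Lemma mulmx_enorm_le M : exists K : R, forall x : 'rV[R]_n,
  enorm (x *m M) <= K * enorm x.
Proof.
exists (\sum_(j < k) \sum_(i < n) `|M i j|) => x.
rewrite (le_trans (enorm_le_sum _))// mulr_suml; apply: ler_sum => j _.
rewrite mxE (le_trans (ler_norm_sum _ _ _))// mulr_suml; apply: ler_sum => i _.
by rewrite normrM mulrC ler_wpM2l// coord_le_enorm.
Qed.

Lemma mulmx_continuous M : continuous (fun x : 'rV[R]_n => x *m M).
Proof.
have [K KP] := mulmx_enorm_le M.
move=> x A /nbhs_eballP[e e0 eA].
have k0 : 0 < `|K| + 1 by rewrite ltr_wpDl.
apply/nbhs_eballP; exists (e / (`|K| + 1)); first by rewrite divr_gt0.
move=> y; rewrite /eball/= (ltr_pdivlMr _ _ k0) mulrC => yx; apply: eA.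
rewrite /eball/= -mulmxBl (le_lt_trans (KP _))// (le_lt_trans _ yx)//.
apply: ler_wpM2r; first exact: enorm_ge0.
by rewrite (le_trans (ler_norm _))// lerDl.
Qed.

Lemma is_derive_mulmx M x v :
  is_derive x v (fun y : 'rV[R]_n => y *m M) (v *m M).
Proof.
have E : \forall h \near 0^',
    h^-1 *: (((fun y : 'rV[R]_n => y *m M) \o shift x) (h *: v) - x *m M) = v *m M.
  near=> h; have h0 : h != 0 by near: h; exact: nbhs_dnbhs_neq.
  by rewrite /= mulmxDl addrK -scalemxAl scalerA mulVf// scale1r.
apply: DeriveDef.
  by apply: (is_cvg_near_cst (v *m M)).
by apply: (@lim_near_cst _ _ _ _ _ (v *m M)).
Unshelve. all: by end_near. Qed.

Lemma is_derive_scalel u h x v dh : is_derive x v h dh ->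
  is_derive x v (fun y => h y *: u) (dh *: u).
Proof.
move=> hx.
have hd : (fun t => t^-1 *: ((h \o shift x) (t *: v) - h x)) @ 0^' --> dh.
  by rewrite -(@derive_val _ _ _ _ _ _ _ hx); exact: (@ex_derive _ _ _ _ _ _ _ hx).
have E : (fun t => t^-1 *: (((fun y => h y *: u) \o shift x) (t *: v) - h x *: u))
    @ 0^' --> dh *: u.
  rewrite (_ : (fun t => _) =
    (fun t => (t^-1 *: ((h \o shift x) (t *: v) - h x)) *: u)); last first.
    by apply/funext => t; rewrite /= -scalerBl scalerA.
  exact: cvgZr_tmp.
by apply: DeriveDef; [apply/cvg_ex; exists (dh *: u)|exact: cvg_lim].
Qed.

Lemma smooth_affine_graph (U : set 'rV[R]_n) M w u h : open U ->
  smooth_on U h -> smooth_on U (fun x => x *m M + w + h x *: u).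
Proof.
move=> oU sh.
pose F (g : 'rV[R]_n -> 'rV[R]_k) := exists M w h, smooth_on U h /\
  g = fun x => x *m M + w + h x *: u.
apply: (@smooth_coind _ _ _ U F) => //; last by exists M, w, h.
  move=> _ [{}M [{}w [{}h [{}sh ->]]]] x Ux.
  apply: continuousD.
    apply: continuousD; first exact: mulmx_continuous.
    exact: cst_continuous.
  apply: continuousZl; exact: smooth_continuous sh Ux.
move=> _ [{}M [{}w [{}h [{}sh ->]]]] i.
exists (fun x => x *m 0 + basis_vec i *m M + 'D_(basis_vec i) h x *: u).
  exists 0, (basis_vec i *m M), ('D_(basis_vec i) h).
  by split; [exact: smooth_partial|exact: erefl].
move=> x Ux; rewrite mulmx0 add0r.
have dh : is_derive x (basis_vec i) h ('D_(basis_vec i) h x).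
  by apply: derivableP; have [_] := sh [::] x Ux.
have dM := is_derive_mulmx M x (basis_vec i).
have dw : is_derive x (basis_vec i) (cst w : 'rV[R]_n -> 'rV[R]_k) 0.
  exact: is_derive_cst.
have dhu := is_derive_scalel u dh.
have := is_deriveD (is_deriveD dM dw) dhu.
by rewrite addr0.
Qed.

End AffineSmooth.

(** * The normal of a smooth convex body *)

Section FirstOrder.
Context {R : realType} {n : nat}.

Lemma smooth_taylor (f : 'rV[R]_n -> R) (U : set 'rV[R]_n) x (e : R) :
  open U -> smooth_on U f -> U x -> 0 < e ->
  exists2 r, 0 < r & forall v, enorm v < r ->
    U (v + x) /\ `|f (v + x) - f x - edot v (grad f x)| <= e * enorm v.
Proof.
move=> oU sf Ux e0.
have [df Df] := smooth_differentiable oU sf Ux.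
have /eqaddoP/(_ e e0)/nbhs_eballP[r r0 rP] := diff_locally df.
have /nbhs_eballP[r' r'0 r'P] : nbhs x U by exact: open_nbhs_nbhs.
exists (Num.min r r'); first by rewrite lt_min r0.
move=> v; rewrite lt_min => /andP[vr vr']; split.
  by apply: r'P; rewrite /eball/= addrK.
have /rP : eball 0 r v by rewrite /eball/= subr0.
move=> h; have {h} : `|f (v + x) - f x - 'd f x v| <= e * `|v|.
  by move: h; congr (`|_| <= _); rewrite /= /shift/= opprD addrA.
rewrite -deriveE// Df => /le_trans; apply.
by rewrite (ler_wpM2l (ltW e0))// norm_le_enorm.
Qed.

Definition normalized (g : 'rV[R]_n) := (enorm g)^-1 *: g.

Lemma enorm_normalized g : g != 0 -> enorm (normalized g) = 1.
Proof.
move=> g0; rewrite enormZ gtr0_norm ?mulVf ?enorm_eq0//.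
by rewrite invr_gt0 lt_def enorm_ge0 enorm_eq0 g0.
Qed.

Lemma normalized_dist_le u v : u != 0 -> v != 0 ->
  enorm (normalized u - normalized v) <= 2 * enorm (u - v) / enorm v.
Proof.
rewrite -!enorm_eq0 => u0 v0.
have up : 0 < enorm u by rewrite lt_def enorm_ge0 u0.
have vp : 0 < enorm v by rewrite lt_def enorm_ge0 v0.
have -> : normalized u - normalized v =
    (enorm v)^-1 *: (u - v) + ((enorm u)^-1 - (enorm v)^-1) *: u.
  by rewrite /normalized scalerBr scalerBl [RHS]addrC subrKA.
apply: (le_trans (enormD _ _)); rewrite !enormZ gtr0_norm ?invr_gt0//.
have -> : `|(enorm u)^-1 - (enorm v)^-1| * enorm u = `|enorm u - enorm v| / enorm v.
  rewrite (_ : (enorm u)^-1 - (enorm v)^-1 =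
    (enorm v - enorm u) * (enorm u * enorm v)^-1); last by field; rewrite u0 v0.
  rewrite normrM distrC (gtr0_norm (_ : 0 < (enorm u * enorm v)^-1)).
    by field; rewrite u0 v0.
  by rewrite invr_gt0 mulr_gt0.
have := enorm_lipschitz u v; rewrite -(ler_pM2r (_ : 0 < (enorm v)^-1)) ?invr_gt0//.
by lra.
Qed.

End FirstOrder.

Section SmoothConvexBody.
Context {R : realType} {n : nat}.
Variable Omega : set 'rV[R]_n.
Hypothesis body : convex_body Omega.
Hypothesis bd_smooth : smooth_boundary Omega.
Let S := boundary Omega.
Let nrm := outward_normal Omega.

Lemma body_closed : closed Omega.
Proof. by have [cO _ _] := body; apply: compact_closed. Qed.

Lemma body_bounded : exists M, forall x, Omega x -> enorm x <= M.
Proof.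
have [cO _ _] := body; have [M [_ MP]] := compact_bounded cO.
exists (n%:R * (M + 1)) => x Ox; apply: (le_trans (enorm_le_norm x)).
by rewrite ler_wpM2l//; apply: MP Ox; rewrite ltrDl.
Qed.

Lemma body_convex x y t : Omega x -> Omega y -> 0 <= t -> t <= 1 ->
  Omega (t *: x + (1 - t) *: y).
Proof.
move=> Ox Oy t0 t1; have [_ cO _] := body.
pose l : {i01 R} := Itv01 t0 t1.
have := cO x y l; rewrite !inE => /(_ Ox Oy).
by [].
Qed.

Lemma boundary_mem x : S x -> Omega x.
Proof. by move=> [+ _]; rewrite -((closure_id Omega).1 body_closed). Qed.

Lemma boundary_notin x : S x -> ~ Omega° x.
Proof. by case. Qed.

Lemma boundaryI x : Omega x -> ~ Omega° x -> S x.
Proof. by move=> Ox nOx; split => //; exact: subset_closure. Qed.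

Lemma defining_function_eq0 w rho :
  S w -> defining_function Omega w rho -> rho w = 0.
Proof.
move=> Sw [U [[oU Uw] srho OU gU]].
have : (Omega `&` U) w by split => //; exact: boundary_mem.
rewrite OU => -[/= rw _]; apply/eqP; rewrite eq_le rw leNgt; apply/negP => rw0.
apply: (boundary_notin Sw).
have near_neg : \forall y \near w, rho y < 0.
  have rc := smooth_continuous srho Uw.
  by apply: (rc [set r | r < 0]); exact: lt_nbhsl.
apply: (@filterS _ (nbhs w) _ _ _ _ (filterI (open_nbhs_nbhs (conj oU Uw)) near_neg)).
move=> y [Uy /ltW ry].
by have : ([set y | rho y <= 0] `&` U) y by []; rewrite -OU => -[].
Qed.

(** On the segment from [w] to [v] the defining function remains nonpositive,
    and it vanishes at [w]. *)
Lemma defining_function_supporting w rho v :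
  S w -> defining_function Omega w rho -> Omega v ->
  edot (v - w) (grad rho w) <= 0.
Proof.
move=> Sw drho Ov; have rw := defining_function_eq0 Sw drho.
have [U [[oU Uw] srho OU gU]] := drho.
rewrite leNgt; apply/negP; set g := edot _ _ => g0.
have N0 : 0 < enorm (v - w).
  rewrite lt_def enorm_ge0 andbT enorm_eq0; apply/eqP => vw.
  by move: g0; rewrite /g vw edot0l ltxx.
have e0 : 0 < g / (2 * enorm (v - w)) by rewrite divr_gt0// mulr_gt0.
have [r r0 rP] := smooth_taylor oU srho Uw e0.
pose t := Num.min 1 (r / (2 * enorm (v - w))).
have t0 : 0 < t by rewrite lt_min ltr01 divr_gt0// mulr_gt0.
have t1 : t <= 1 by rewrite ge_min lexx.
have [|Ut] := rP (t *: (v - w)).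
  rewrite enormZ (gtr0_norm t0).
  have : t <= r / (2 * enorm (v - w)) by rewrite /t ge_min lexx orbT.
  rewrite ler_pdivlMr ?mulr_gt0//; lra.
have Ot : Omega (t *: (v - w) + w).
  rewrite (_ : _ + w = t *: v + (1 - t) *: w).
    by apply: body_convex => //; [exact: boundary_mem|exact: ltW].
  by rewrite scalerBr scalerBl scale1r -addrA (addrC (- _)).
have : (Omega `&` U) (t *: (v - w) + w) by [].
rewrite OU => -[/= rt _]; rewrite rw subr0 edotZl -/g enormZ (gtr0_norm t0).
rewrite ler_norml => /andP[+ _].
rewrite (_ : g / _ * _ = t * g / 2); last by field; rewrite gt_eqF.
have tg : 0 < t * g by rewrite mulr_gt0.
lra.
Qed.

Lemma defining_function_enters w rho u :
  S w -> defining_function Omega w rho -> edot u (grad rho w) < 0 ->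
  exists2 t, 0 < t & Omega (t *: u + w).
Proof.
move=> Sw drho g0; have rw := defining_function_eq0 Sw drho.
have [U [[oU Uw] srho OU gU]] := drho.
set g := edot _ _ in g0.
have N0 : 0 < enorm u.
  rewrite lt_def enorm_ge0 andbT enorm_eq0; apply/eqP => u0.
  by move: g0; rewrite /g u0 edot0l ltxx.
have e0 : 0 < - g / enorm u by rewrite divr_gt0// oppr_gt0.
have [r r0 rP] := smooth_taylor oU srho Uw e0.
pose t := r / (2 * enorm u).
have t0 : 0 < t by rewrite divr_gt0// mulr_gt0.
exists t => //.
have [|Ut] := rP (t *: u).
  rewrite enormZ (gtr0_norm t0).
  have -> : t * enorm u = r / 2 by rewrite /t; field; rewrite gt_eqF.
  by rewrite ltr_pdivrMr// ltr_pMr// ltr1n.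
rewrite rw subr0 edotZl -/g enormZ (gtr0_norm t0) ler_norml => /andP[_].
rewrite (_ : - g / _ * _ = t * - g); last by field; rewrite gt_eqF.
move=> h; have : ([set y | rho y <= 0] `&` U) (t *: u + w) by split=> //=; lra.
by rewrite -OU => -[].
Qed.

(** A direction pointing strictly inwards for one defining function enters
    [Omega], hence does not point strictly outwards for the other one. *)
Lemma defining_function_normal_unique w rho1 rho2 :
  S w -> defining_function Omega w rho1 -> defining_function Omega w rho2 ->
  normalized (grad rho1 w) = normalized (grad rho2 w).
Proof.
move=> Sw d1 d2.
have g0 rho : defining_function Omega w rho -> grad rho w != 0.
  by move=> [U [[_ Uw] _ _ gU]]; exact: gU.
have e0 rho : defining_function Omega w rho -> 0 < enorm (grad rho w).
  by move=> /g0 h; rewrite lt_def enorm_ge0 enorm_eq0 h.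
have u1 := enorm_normalized (g0 _ d1); have u2 := enorm_normalized (g0 _ d2).
set a := normalized _ in u1 *; set b := normalized _ in u2 *.
apply/eqP; rewrite -subr_eq0 -enorm_eq0 -sqrf_eq0 (enorm_unit_dist u1 u2).
have ab : edot a b <= 1 by rewrite (le_trans (edot_le _ _))// u1 u2 mulr1.
have [ab1|] := leP 1 (edot a b).
  by rewrite (_ : edot a b = 1) ?subrr ?mulr0//; apply/le_anti/andP.
move=> ab1.
have [t t0 Ot] : exists2 t, 0 < t & Omega (t *: (b - a) + w).
  apply: (defining_function_enters Sw d1).
  have -> : grad rho1 w = enorm (grad rho1 w) *: a.
    by rewrite /a /normalized scalerA divff ?scale1r// gt_eqF ?e0.
  rewrite edotZr pmulr_rlt0 ?e0// edotBl (edotC b) -(enorm2 a) u1 expr1n.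
  by rewrite subr_lt0.
have := defining_function_supporting Sw d2 Ot.
have -> : grad rho2 w = enorm (grad rho2 w) *: b.
  by rewrite /b /normalized scalerA divff ?scale1r// gt_eqF ?e0.
rewrite addrK edotZr edotZl pmulr_rle0 ?e0// pmulr_rle0// edotBl -(enorm2 b) u2.
rewrite expr1n => h; lra.
Qed.

Lemma outward_normalE w rho : S w -> defining_function Omega w rho ->
  nrm w = normalized (grad rho w).
Proof.
move=> Sw drho; rewrite /nrm /outward_normal; case: xgetP => [nu _ [rho' d' ->]|].
  exact: (defining_function_normal_unique Sw d' drho).
by move=> /(_ (normalized (grad rho w))); case; exists rho.
Qed.

Lemma enorm_normal w : S w -> enorm (nrm w) = 1.
Proof.
move=> Sw; have [rho drho] := bd_smooth Sw; rewrite (outward_normalE Sw drho).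
by apply: enorm_normalized; have [U [[_ Uw] _ _ gU]] := drho; exact: gU.
Qed.

Lemma normal_supporting w v : S w -> Omega v -> edot (v - w) (nrm w) <= 0.
Proof.
move=> Sw Ov; have [rho drho] := bd_smooth Sw; rewrite (outward_normalE Sw drho).
rewrite edotZr mulr_ge0_le0 ?invr_ge0 ?enorm_ge0//.
exact: defining_function_supporting.
Qed.

Lemma normal_continuous y : S y -> forall e, 0 < e ->
  exists2 r, 0 < r & forall z, S z -> eball y r z -> enorm (nrm z - nrm y) < e.
Proof.
move=> Sy e e0; have [rho drho] := bd_smooth Sy.
have [U [[oU Uy] srho OU gU]] := drho.
have gy : 0 < enorm (grad rho y) by rewrite lt_def enorm_ge0 enorm_eq0 gU.
pose e' := e * enorm (grad rho y) / (2 * (n%:R + 1)).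
have n1 : 0 < n%:R + 1 :> R by rewrite ltr_wpDl.
have e'0 : 0 < e' by rewrite divr_gt0// mulr_gt0.
have near_partials : \forall z \near y, forall i,
    `|'D_(basis_vec i) rho z - 'D_(basis_vec i) rho y| < e'.
  apply: (@filter_forall _ _ (fun i z =>
    `|'D_(basis_vec i) rho z - 'D_(basis_vec i) rho y| < e') (nbhs y)) => i.
  have near_i := (srho [:: i] y Uy).1 _ (nbhsx_ballx ('D_(basis_vec i) rho y) _ e'0).
  by apply: (@filterS _ (nbhs y) _ _ _ _ near_i) => z; rewrite /= distrC.
have /nbhs_eballP[r1 r10 r1U] : nbhs y U by exact: open_nbhs_nbhs.
have /nbhs_eballP[r2 r20 r2P] := near_partials.
exists (Num.min r1 r2); first by rewrite lt_min r10.
move=> z Sz; rewrite /eball/= lt_min => /andP[/r1U Uz /r2P gz].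
have drhoz : defining_function Omega z rho by exists U.
rewrite (outward_normalE Sz drhoz) (outward_normalE Sy drho).
apply: (le_lt_trans (normalized_dist_le (gU _ Uz) (gU _ Uy))).
rewrite ltr_pdivrMr//.
have : enorm (grad rho z - grad rho y) <= n%:R * e'.
  apply: (le_trans (enorm_le_sum _)).
  have -> : n%:R * e' = \sum_(i < n) e' by rewrite mulr_natl sumr_const card_ord.
  by apply: ler_sum => i _; rewrite !mxE ltW.
have -> : n%:R * e' = e * enorm (grad rho y) / 2 - e'.
  by rewrite /e'; field; rewrite gt_eqF.
lra.
Qed.

(** The centre is moved inwards by [3/2 t]: on the ball the linear part of the
    defining function is then at most [- t/2] times the norm of its gradient,
    twice the possible error. *)
Lemma interior_ball_near_boundary w : S w -> exists t z,
  [/\ 0 < t, eball z t `<=` Omega & enorm (z - w) <= 2 * t].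
Proof.
move=> Sw; have [rho drho] := bd_smooth Sw.
have rw := defining_function_eq0 Sw drho.
have [U [[oU Uw] srho OU gU]] := drho.
set G := enorm (grad rho w).
have G0 : 0 < G by rewrite lt_def enorm_ge0 enorm_eq0 gU.
have e0 : 0 < G / 10 by rewrite divr_gt0.
have [r r0 rP] := smooth_taylor oU srho Uw e0.
pose t := r / 3; have t0 : 0 < t by rewrite divr_gt0.
set nu := normalized (grad rho w).
have nu1 : enorm nu = 1 by apply: enorm_normalized; exact: gU.
have gE : grad rho w = G *: nu.
  by rewrite /nu /normalized scalerA divff ?scale1r// gt_eqF.
exists t, (w - (3 / 2 * t) *: nu); split=> //; last first.
  rewrite addrAC subrr sub0r enormN enormZ nu1 mulr1 ger0_norm; lra.
move=> x; rewrite /eball/= => xt.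
set u := x - _ in xt.
have xE : x = (u - (3 / 2 * t) *: nu) + w.
  by apply/rowP => i; rewrite /u !mxE; ring.
have un := enormB u ((3 / 2 * t) *: nu).
rewrite [enorm (_ *: _)]enormZ nu1 mulr1 ger0_norm in un; last by lra.
have [|Ux] := rP (u - (3 / 2 * t) *: nu); first by rewrite /t in xt un *; lra.
rewrite -xE in Ux *; rewrite rw subr0 gE edotZr edotBl edotZl -enorm2 nu1 expr1n mulr1.
rewrite ler_norml => /andP[_].
have unu := edot_le u nu; rewrite nu1 mulr1 in unu.
have : G / 10 * enorm (u - (3 / 2 * t) *: nu) <= G * (t / 4).
  rewrite -mulrA (ler_pM2l G0); lra.
have : G * (edot u nu - 3 / 2 * t) <= G * (- (t / 2)) by rewrite (ler_pM2l G0); lra.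
have : 0 < G * t by rewrite mulr_gt0.
move=> h1 h2 h3 h4; have rx : rho x <= 0 by lra.
by have : ([set y | rho y <= 0] `&` U) x by []; rewrite -OU => -[].
Qed.

End SmoothConvexBody.

(** * Coordinates adapted to a direction *)

Section Charts.
Context {R : realType} {d : nat}.
Implicit Types (P : 'M[R]_(d + 1)) (u v : 'rV[R]_(d + 1)) (t : 'rV[R]_d) (h : R).

(** [rotated_graph] is a translate of [chart] along a graph. *)
Definition chart P t h : 'rV[R]_(d + 1) := row_mx t h%:M *m P^T.
Definition base_part P v : 'rV[R]_d := lsubmx (v *m P).
Definition height_part P v : R := rsubmx (v *m P) 0 0.

Lemma chart_add P t1 t2 h1 h2 :
  chart P (t1 + t2) (h1 + h2) = chart P t1 h1 + chart P t2 h2.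
Proof. by rewrite /chart raddfD/= -add_row_mx mulmxDl. Qed.

Lemma chart_scale P a t h : chart P (a *: t) (a * h) = a *: chart P t h.
Proof. by rewrite /chart -scale_scalar_mx -scale_row_mx scalemxAl. Qed.

Lemma chart_split P t h : chart P t h = chart P t 0 + h *: chart P 0 1.
Proof. by rewrite -chart_scale -chart_add scaler0 mulr1 addr0 add0r. Qed.

Lemma chart0 P : chart P 0 0 = 0.
Proof. by rewrite /chart raddf0 row_mx0 mul0mx. Qed.

Lemma base_partD P u v : base_part P (u + v) = base_part P u + base_part P v.
Proof. by rewrite /base_part mulmxDl raddfD. Qed.

Lemma base_partZ P a u : base_part P (a *: u) = a *: base_part P u.
Proof. by rewrite /base_part -scalemxAl linearZ. Qed.

Lemma base_partB P u v : base_part P (u - v) = base_part P u - base_part P v.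
Proof. by rewrite base_partD -scaleN1r base_partZ scaleN1r. Qed.

Lemma height_partD P u v : height_part P (u + v) = height_part P u + height_part P v.
Proof. by rewrite /height_part mulmxDl raddfD mxE. Qed.

Lemma height_partZ P a u : height_part P (a *: u) = a * height_part P u.
Proof. by rewrite /height_part -scalemxAl linearZ/= mxE. Qed.

Lemma height_partB P u v : height_part P (u - v) = height_part P u - height_part P v.
Proof. by rewrite height_partD -scaleN1r height_partZ mulN1r. Qed.

Section Orthogonal.
Variable P : 'M[R]_(d + 1).
Hypothesis orthP : P *m P^T = 1%:M.

Let orthP' : P^T *m P = 1%:M.
Proof. exact: mulmx1C. Qed.

Lemma base_part_chart t h : base_part P (chart P t h) = t.
Proof. by rewrite /base_part /chart -mulmxA orthP' mulmx1 row_mxKl. Qed.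

Lemma height_part_chart t h : height_part P (chart P t h) = h.
Proof. by rewrite /height_part /chart -mulmxA orthP' mulmx1 row_mxKr mxE eqxx. Qed.

Lemma chart_parts v : chart P (base_part P v) (height_part P v) = v.
Proof.
rewrite /chart /base_part /height_part.
rewrite (_ : (rsubmx (v *m P) 0 0)%:M = rsubmx (v *m P)); last first.
  by apply/matrixP => i j; rewrite !ord1 !mxE eqxx.
by rewrite hsubmxK -mulmxA orthP mulmx1.
Qed.

Lemma edot_parts u v : edot u v =
  edot (base_part P u) (base_part P v) + height_part P u * height_part P v.
Proof.
have -> : edot u v = edot (u *m P) (v *m P).
  by rewrite !edot_mulmx trmx_mul mulmxA -(mulmxA u) orthP mulmx1.
rewrite /edot big_split_ord/= big_ord1 /base_part /height_part; congr (_ + _ * _).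
- by apply: eq_bigr => i _; rewrite !mxE.
- by rewrite !mxE.
- by rewrite !mxE.
Qed.

Lemma edot_chart t1 t2 h1 h2 :
  edot (chart P t1 h1) (chart P t2 h2) = edot t1 t2 + h1 * h2.
Proof. by rewrite edot_parts !base_part_chart !height_part_chart. Qed.

Lemma height_part_edot v : height_part P v = edot v (chart P 0 1).
Proof.
by rewrite (edot_parts v) base_part_chart height_part_chart edot0r add0r mulr1.
Qed.

Lemma enorm_chart_base t : enorm (chart P t 0) = enorm t.
Proof. by rewrite /enorm edot_chart mul0r addr0. Qed.

Lemma enorm_chart_axis : enorm (chart P 0 1) = 1.
Proof. by rewrite /enorm edot_chart edot0l add0r mulr1 sqrtr1. Qed.

Lemma enorm_base_part v : enorm (base_part P v) <= enorm v.
Proof.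
rewrite ler_sqrt; last exact: edot_ge0.
by rewrite (edot_parts v v) lerDl -expr2 sqr_ge0.
Qed.

Lemma height_part_le v : `|height_part P v| <= enorm v.
Proof.
rewrite height_part_edot (le_trans (edot_abs_le _ _))//.
by rewrite enorm_chart_axis mulr1.
Qed.

Lemma enorm_le_parts v : enorm v <= enorm (base_part P v) + `|height_part P v|.
Proof.
rewrite -{1}(chart_parts v) chart_split (le_trans (enormD _ _))//.
by rewrite enorm_chart_base enormZ enorm_chart_axis mulr1.
Qed.

End Orthogonal.

Definition householder (u : 'rV[R]_(d + 1)) : 'M[R]_(d + 1) :=
  1%:M - (2 / edot u u) *: (u^T *m u).

Lemma householder_sym u : (householder u)^T = householder u.
Proof. by rewrite /householder linearB linearZ/= trmx_mul trmxK trmx1. Qed.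

Lemma householder_invol u : u != 0 -> householder u *m householder u = 1%:M.
Proof.
move=> u0; have uu : edot u u != 0 by rewrite edot_eq0.
have usq : (u^T *m u) *m (u^T *m u) = edot u u *: (u^T *m u).
  rewrite mulmxA -(mulmxA _ u) [u *m u^T]mx11_scalar -edot_mulmx.
  by rewrite mul_mx_scalar -scalemxAl.
rewrite /householder mulmxBl !mulmxBr !mul1mx !mulmx1.
rewrite -scalemxAl -scalemxAr usq !scalerA.
set A := u^T *m u; set k := edot u u in uu *.
rewrite (_ : 2 / k * (2 / k) * k = 2 / k + 2 / k); last by field.
by rewrite scalerDl opprB addrK subrK.
Qed.

(** A Householder reflection does it up to the sign of the determinant, which is
    corrected by reversing the first coordinate; that one is not the axis
    because [0 < d]. *)
Lemma rotation_to_axis (nu : 'rV[R]_(d + 1)) : (0 < d)%N -> enorm nu = 1 ->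
  exists2 P : 'M[R]_(d + 1), special_orthogonal P & chart P 0 1 = nu.
Proof.
move=> d0 nu1; pose e : 'rV[R]_(d + 1) := row_mx 0 1%:M.
have [H [HH He]] : exists H : 'M[R]_(d + 1), H *m H^T = 1%:M /\ e *m H^T = nu.
  have [->|ne] := eqVneq nu e; first by exists 1%:M; rewrite trmx1 !mulmx1.
  pose u := nu - e; have u0 : u != 0 by rewrite subr_eq0.
  exists (householder u); rewrite householder_sym; split.
    exact: householder_invol.
  have uu : edot u u != 0 by rewrite edot_eq0.
  have e1 : edot e e = 1.
    have one1 : 1%:M *m (1%:M)^T = 1%:M :> 'M[R]_(d + 1) by rewrite trmx1 mulmx1.
    have := edot_chart one1 0 0 1 1.
    by rewrite /chart trmx1 !mulmx1 edot0l add0r mulr1.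
  have nn : edot nu nu = 1 by rewrite -enorm2 nu1 expr1n.
  have eu : edot u u = - 2 * edot e u.
    rewrite /u !edotE (edotC e nu) nn e1; ring.
  rewrite /householder mulmxBr mulmx1 -scalemxAr mulmxA [e *m u^T]mx11_scalar.
  rewrite -edot_mulmx mul_scalar_mx scalerA eu.
  rewrite (_ : 2 / (-2 * edot e u) * edot e u = -1); last first.
    by field; move: uu; rewrite eu mulf_eq0 negb_or => /andP[].
  by rewrite scaleN1r opprK /u addrC subrK.
have dH : \det H ^+ 2 = 1.
  by have := congr1 determinant HH; rewrite det_mulmx det_tr det1 expr2.
move/eqP: dH; rewrite sqrf_eq1 => /orP[/eqP dH|/eqP dH].
  by exists H.
pose i0 : 'I_(d + 1) := lshift 1 (Ordinal d0).
pose F : 'M[R]_(d + 1) := diag_mx (\row_i if i == i0 then -1 else 1).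
have FT : F^T = F by rewrite tr_diag_mx.
have FF : F *m F = 1%:M.
  apply/matrixP => i j; rewrite mul_diag_mx !mxE.
  case: (i == i0); case: (i == j);
    by rewrite /= ?mulr1n ?mulr0n ?mulN1r ?mul1r ?opprK ?oppr0.
exists (H *m F).
  split; first by rewrite trmx_mul FT mulmxA -(mulmxA H) FF mulmx1.
  rewrite det_mulmx dH det_diag (bigD1 i0)//= mxE eqxx big1 ?mulr1 ?mulrNN ?mulr1//.
  by move=> i /negbTE ii; rewrite mxE ii.
rewrite /chart trmx_mul FT mulmxA (_ : row_mx 0 1%:M *m F = e)//.
apply/rowP => i; rewrite mul_mx_diag !mxE.
case: eqP => [->|_]; last by rewrite mulr1.
by case: split_ordP => j; [rewrite mxE mul0r|move/eqP; rewrite eq_lrshift].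
Qed.

End Charts.

(** * Comparison of normals through nearby hyperplanes *)

Section SlopeComparison.
Context {R : realType} {d : nat}.

(** Centres for cells that surround a point: half an inner radius away along
    each axis, in both orientations. *)
Definition direction (r : R) (j : 'I_d * bool) : 'rV[R]_d :=
  ((-1) ^+ j.2 * (r / 2)) *: basis_vec j.1.

(** In absolute value the largest coordinate of [e] is at least the [d]-th part
    of the sum of all, and a displacement by [r/2] along it dominates errors of
    [r / (4 d)] in all coordinates. *)
Lemma exists_aligned_direction (r : R) (e : 'rV[R]_d) : (0 < d)%N -> 0 < r ->
  exists j, forall t : 'rV[R]_d,
    (forall k, `|t 0 k - direction r j 0 k| <= r / (4 * d%:R)) ->
    r / (4 * d%:R) * enorm e <= edot t e.
Proof.
move=> d0 r0; have dR : 0 < d%:R :> R by rewrite ltr0n.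
pose i := [arg max_(k > Ordinal d0) `|e 0 k|]%O.
have imax k : `|e 0 k| <= `|e 0 i|.
  by rewrite /i; case: arg_maxP => // i' _; apply.
have e_le : \sum_(k < d) `|e 0 k| <= d%:R * `|e 0 i|.
  rewrite mulr_natl -[X in _ *+ X]card_ord -sumr_const.
  by apply: ler_sum => k _; exact: imax.
exists (i, e 0 i < 0) => t tj.
(* The first term is attained at the centre of the cell. *)
have ge : r / 2 * `|e 0 i| - r / (4 * d%:R) * \sum_(k < d) `|e 0 k| <= edot t e.
  have -> : edot t e = edot (direction r (i, e 0 i < 0)) e +
      edot (t - direction r (i, e 0 i < 0)) e by rewrite edotBl addrC subrK.
  have -> : edot (direction r (i, e 0 i < 0)) e = r / 2 * `|e 0 i|.
    rewrite edotZl /edot (bigD1 i)//= mxE !eqxx mul1r big1 ?addr0; last first.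
      by move=> k ki; rewrite mxE (negbTE ki) andbF mul0r.
    rewrite /=; case: (ltrP (e 0 i) 0) => ei.
      by rewrite ltr0_norm// expr1; ring.
    by rewrite ger0_norm// expr0; ring.
  rewrite lerD2l lerNl -edotNl mulr_sumr; apply: ler_sum => k _.
  rewrite (le_trans (ler_norm _))// normrM ler_wpM2r//.
  by have := tj k; rewrite !mxE normrN.
apply: le_trans ge; have c0 : 0 < r / (4 * d%:R) by rewrite divr_gt0// mulr_gt0.
have h1 : r / (4 * d%:R) * \sum_(k < d) `|e 0 k| <= r / 4 * `|e 0 i|.
  rewrite (_ : r / 4 * _ = r / (4 * d%:R) * (d%:R * `|e 0 i|)).
    by rewrite (ler_pM2l c0).
  by field; rewrite gt_eqF.
have h2 : r / (4 * d%:R) * enorm e <= r / (4 * d%:R) * \sum_(k < d) `|e 0 k|.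
  by rewrite (ler_pM2l c0) enorm_le_sum.
lra.
Qed.

(** Two unit vectors that are almost normal to the same graph are close: [n] is
    normal at [w], while the hyperplane through [w] orthogonal to [nu] passes at
    most [M] above points of the graph lying in all coordinate directions around
    [w].  Each of these directions bounds the difference of the slopes of the two
    hyperplanes from one side.  That [nu] is not nearly horizontal follows from the
    depth of [z] below a point [x j] lying in the direction opposite to the
    horizontal part of [nu]. *)
Lemma normals_close (P : 'M[R]_(d + 1)) (z w n nu : 'rV[R]_(d + 1))
    (x : 'I_d * bool -> 'rV[R]_(d + 1)) (r D M : R) :
  (0 < d)%N -> P *m P^T = 1%:M -> 0 < r -> 0 <= M -> M <= r / 2 ->
  enorm n = 1 -> enorm nu = 1 ->
  w - z = D *: chart P 0 1 -> 0 < D -> r <= edot (w - z) n ->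
  (forall j, edot (x j - w) n <= 0) ->
  (forall j, - M <= edot (x j - w) nu) ->
  (forall j, r - M <= edot (x j - z) nu) ->
  (forall j k, `|base_part P (x j - z) 0 k - direction r j 0 k| <= r / (4 * d%:R)) ->
  (forall j, 0 < height_part P (x j - z) <= 16 * r) ->
  enorm (n - nu) <= 256 * d%:R * M / r.
Proof.
move=> d0 orthP r0 M0 Mr n1 nu1 wz D0 rn xn xnu xz xdir xh.
have dR : 0 < d%:R :> R by rewrite ltr0n.
set nt := height_part P n; set mt := height_part P nu.
set nb := base_part P n; set mb := base_part P nu.
have nt0 : 0 < nt.
  move: rn; rewrite wz edotZl edotC -(height_part_edot orthP) -/nt => rn.
  by rewrite -(pmulr_rgt0 _ D0) (lt_le_trans r0).
have mt0 : 32^-1 <= mt.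
  have [j jP] := exists_aligned_direction (- mb) d0 r0.
  have := xz j; rewrite (edot_parts orthP) -/mt -/mb.
  have := jP _ (xdir j); rewrite edotNr enormN.
  have := enorm_ge0 mb; have c0 : 0 < r / (4 * d%:R) by rewrite divr_gt0// mulr_gt0.
  move: (xh j); set h := height_part P (x j - z) => /andP[h0 h16].
  move=> mb0 h1 h2.
  have h3 : 0 <= r / (4 * d%:R) * enorm mb by rewrite mulr_ge0// ltW.
  have h4 : r / 2 <= h * mt by lra.
  have mtp : 0 < mt by rewrite -(pmulr_rgt0 _ h0); lra.
  have h5 : h * mt <= 16 * r * mt by rewrite (ler_pM2r mtp).
  have : r * 32^-1 <= r * mt by lra.
  by rewrite (ler_pM2l r0).
have mtp : 0 < mt by lra.
pose b := mt^-1 *: mb - nt^-1 *: nb.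
have xb j : - (32 * M) <= edot (base_part P (x j - z)) b.
  have zw v : edot (x j - w) v = edot (base_part P (x j - z)) (base_part P v) +
      (height_part P (x j - z) - D) * height_part P v.
    have -> : x j - w = (x j - z) - (w - z) by rewrite opprB addrA subrK.
    rewrite wz edotBl edotZl (edotC (chart P 0 1)) -(height_part_edot orthP).
    by rewrite (edot_parts orthP); ring.
  have := xn j; have := xnu j; rewrite !zw -/nt -/mt -/nb -/mb.
  rewrite /b edotBr !edotZr; set A := edot _ nb; set B := edot _ mb.
  set h := _ - D => h1 h2.
  have h3 : nt^-1 * A + h <= 0.
    by rewrite -(pmulr_rle0 _ nt0) mulrDr mulrA divff ?gt_eqF// mul1r mulrC; lra.
  have h4 : - (32 * M) <= mt^-1 * B + h.
    rewrite -(ler_pM2l mtp) mulrDr mulrA divff ?gt_eqF// mul1r.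
    have : M <= mt * 32 * M by rewrite -{1}[M]mul1r ler_wpM2r//; lra.
    lra.
  lra.
have bM : enorm b <= 128 * d%:R * M / r.
  have [j jP] := exists_aligned_direction (- b) d0 r0.
  have := jP _ (xdir j); rewrite edotNr enormN => h1; have h2 := xb j.
  rewrite ler_pdivlMr//.
  have h3 : r / (4 * d%:R) * enorm b <= 32 * M by lra.
  move: h3; rewrite mulrAC ler_pdivrMr ?mulr_gt0//; lra.
have nE : n = normalized (nt^-1 *: n).
  by rewrite /normalized enormZ n1 mulr1 gtr0_norm ?invr_gt0// invrK scalerA
    divff ?scale1r// gt_eqF.
have mE : nu = normalized (mt^-1 *: nu).
  by rewrite /normalized enormZ nu1 mulr1 gtr0_norm ?invr_gt0// invrK scalerA
    divff ?scale1r// gt_eqF.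
have unz (a : R) v : 0 < a -> enorm v = 1 -> a^-1 *: v != 0 :> 'rV[R]_(d + 1).
  by move=> a0 v1; rewrite -enorm_eq0 enormZ v1 mulr1 normr_eq0 invr_eq0 gt_eqF.
rewrite nE mE (le_trans (normalized_dist_le (unz _ _ nt0 n1) (unz _ _ mtp nu1)))//.
rewrite [enorm (mt^-1 *: _)]enormZ nu1 mulr1 gtr0_norm ?invr_gt0// invrK.
have mt1 : mt <= 1.
  by rewrite (le_trans (ler_norm _))// (le_trans (height_part_le orthP _))// nu1.
have diff : enorm (nt^-1 *: n - mt^-1 *: nu) <= enorm b.
  rewrite (le_trans (enorm_le_parts orthP _))//.
  rewrite base_partB height_partB !base_partZ !height_partZ -/nt -/mt -/nb -/mb.
  by rewrite !mulVf ?gt_eqF// subrr normr0 addr0 enormC.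
have : 2 * enorm (nt^-1 *: n - mt^-1 *: nu) * mt <= 2 * enorm b.
  by rewrite -mulrA ler_pM2l// (le_trans _ diff)// ler_piMr// enorm_ge0.
move=> /le_trans; apply; lra.
Qed.

End SlopeComparison.

(** * Cells of the boundary *)

Section LinesAndBalls.
Context {R : realType} {n : nat}.
Variable Omega : set 'rV[R]_n.
Hypothesis body : convex_body Omega.
Hypothesis bd_smooth : smooth_boundary Omega.
Let S := boundary Omega.
Let nrm := outward_normal Omega.

Lemma line_top (u v : 'rV[R]_n) : enorm v = 1 -> (exists h, Omega (u + h *: v)) ->
  exists2 h, S (u + h *: v) & forall h', Omega (u + h' *: v) -> h' <= h.
Proof.
move=> v1 [h0 Oh0]; pose A := [set h | Omega (u + h *: v)].
have dist (a b : R) : enorm ((u + a *: v) - (u + b *: v)) = `|a - b|.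
  by rewrite opprD addrACA subrr add0r -scalerBl enormZ v1 mulr1.
have supA : has_sup A.
  split; first by exists h0.
  have [M MP] := body_bounded body; exists (M + enorm u) => h /MP hM.
  have := enormB (u + h *: v) u.
  rewrite addrC addKr enormZ v1 mulr1; have := ler_norm h; lra.
exists (sup A); last by move=> h' Oh'; apply: ub_le_sup => //; case: supA.
apply: boundaryI.
  apply: contrapT => nO.
  have : nbhs (u + sup A *: v) (~` Omega).
    by apply: open_nbhs_nbhs; split => //; by apply: closed_openC; exact: (body_closed body).
  move=> /nbhs_eballP[e e0 eO].
  have [a Aa aA] := sup_adherent e0 supA.
  apply: (eO (u + a *: v)) => //.
  have aS : a <= sup A by apply: ub_le_sup => //; case: supA.
  by rewrite /eball/= dist distrC ger0_norm ?subr_ge0//; lra.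
move=> /nbhs_eballP[e e0 eO].
have : A (sup A + e / 2).
  apply: eO; rewrite /eball/= dist addrAC subrr add0r gtr0_norm ?divr_gt0//; lra.
have ub : ubound A (sup A) by move=> a Aa; apply: ub_le_sup => //; case: supA.
by move=> /ub; rewrite gerDl leNgt divr_gt0.
Qed.

Lemma inner_ball_support z r w : eball z r `<=` Omega -> S w -> 0 < r ->
  r <= edot (w - z) (nrm w).
Proof.
move=> zr Sw r0; have n1 := enorm_normal body bd_smooth Sw.
apply/ler_addgt0Pr => e e0.
pose r' := r - Num.min e r.
have m0 : 0 < Num.min e r by rewrite lt_min e0.
have mr : Num.min e r <= r by rewrite ge_min lexx orbT.
have me : Num.min e r <= e by rewrite ge_min lexx.
have Or : Omega (z + r' *: nrm w).
  apply: zr; rewrite /eball/= addrC addKr enormZ n1 mulr1 ger0_norm /r'; lra.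
have := normal_supporting body bd_smooth Sw Or.
rewrite -/nrm !edotE -enorm2 n1 expr1n mulr1 /r'; lra.
Qed.

Lemma inner_ball_dist z r w : eball z r `<=` Omega -> S w -> 0 < r ->
  r <= enorm (w - z).
Proof.
move=> zr Sw r0; apply: (le_trans (inner_ball_support zr Sw r0)).
by rewrite (le_trans (edot_le _ _))// (enorm_normal body bd_smooth Sw) mulr1.
Qed.

End LinesAndBalls.

Section Cells.
Context {R : realType} {d : nat}.
Variable Omega : set 'rV[R]_(d + 1).
Hypothesis d0 : (0 < d)%N.
Hypothesis body : convex_body Omega.
Hypothesis bd_smooth : smooth_boundary Omega.
Let S := boundary Omega.
Let nrm := outward_normal Omega.
Variable P : 'M[R]_(d + 1).
Hypothesis orthP : P *m P^T = 1%:M.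

(** Part of the boundary above a cube of the hyperplane through [z]; the
    positive height selects the sheet in the direction of the axis. *)
Definition cell (z : 'rV[R]_(d + 1)) (r : R) (t : 'rV[R]_d) :=
  boundary Omega `&` [set v | 0 < height_part P (v - z)] `&`
    [set v | `|base_part P (v - z) - t| < r / (4 * d%:R)].

Lemma cell_caratheodory z r t : (@hausdorff_outer R (d + 1) d).-caratheodory (cell z r t).
Proof.
apply: caratheodory_measurable_setI.
  apply: caratheodory_measurable_setI; first exact: caratheodory_boundary.
  apply: caratheodory_open; rewrite openE => v v0.
  have hc : {for v, continuous (fun v : 'rV[R]_(d + 1) => height_part P (v - z))}.
    apply: (@lipschitz_enorm_continuous _ _ _ 1) => y.
    rewrite mul1r -height_partB opprB addrA subrK.
    exact: (height_part_le orthP).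
  exact: (hc [set h | 0 < h] (lt_nbhsr v0)).
apply: caratheodory_open; rewrite openE => v vt.
have bc : {for v, continuous (fun v : 'rV[R]_(d + 1) => `|base_part P (v - z) - t|)}.
  apply: (@lipschitz_enorm_continuous _ _ _ 1) => y.
  rewrite mul1r (le_trans (ler_dist_dist _ _))//.
  rewrite opprB addrA subrK -base_partB opprB addrA subrK.
  by rewrite (le_trans (norm_le_enorm _))// (enorm_base_part orthP).
exact: (bc [set h | h < r / (4 * d%:R)] (lt_nbhsl vt)).
Qed.

(** Every line parallel to the axis above the cube starts inside [Omega] and
    leaves it in the cell, so that the cell projects onto the cube. *)
Lemma cell_measure z r t : 0 < r -> eball z r `<=` Omega ->
  (forall t', `|t' - t| < r / (4 * d%:R) -> enorm t' < r) ->
  ((@cube_constant R d * (r / (8 * d%:R)) ^+ d)%:E <=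
    hausdorff_outer d (cell z r t))%E.
Proof.
move=> r0 zr tr; have dR : 0 < d%:R :> R by rewrite ltr0n.
have a0 : 0 < r / (8 * d%:R) by rewrite divr_gt0// mulr_gt0.
apply: (@hausdorff_outer_ge_cube _ _ _ _ (fun v => base_part P (v - z)) t) => //.
  move=> x y i.
  have -> : base_part P (x - z) 0 i - base_part P (y - z) 0 i = base_part P (x - y) 0 i.
    by rewrite !base_partB !mxE; ring.
  by rewrite (le_trans (coord_le_enorm _ _))// (enorm_base_part orthP).
move=> t' /= t't.
have t't_lt : `|t' - t| < r / (4 * d%:R).
  apply: (@le_lt_trans _ _ (r / (8 * d%:R))).
    rewrite [leLHS]/Num.norm /= mx_normrE; apply/bigmax_leP; split=> [|[i j] _].
      exact: ltW.
    by rewrite ord1 !mxE t't.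
  have -> : r / (4 * d%:R) = 2 * (r / (8 * d%:R)) by field; rewrite gt_eqF.
  lra.
have subE (a b e : 'rV[R]_(d + 1)) : a + b + e - a = b + e.
  by rewrite -(addrA a) addrAC subrr add0r.
have base_in h : `|h| < r - enorm t' -> Omega (z + chart P t' 0 + h *: chart P 0 1).
  move=> hr; apply: zr; rewrite /eball/= subE.
  rewrite (le_lt_trans (enormD _ _))// (enorm_chart_base orthP) enormZ.
  rewrite (enorm_chart_axis orthP); lra.
have t'r := tr _ t't_lt.
have [||h Sh hmax] := line_top body (u := z + chart P t' 0) (v := chart P 0 1).
  exact: enorm_chart_axis.
  by exists 0; apply: base_in; rewrite normr0 subr_gt0.
have vz : z + chart P t' 0 + h *: chart P 0 1 - z = chart P t' h.
  by rewrite subE -chart_split.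
have h0 : 0 < h.
  have : (r - enorm t') / 2 <= h.
    by apply: hmax; apply: base_in; rewrite gtr0_norm; lra.
  lra.
exists (z + chart P t' 0 + h *: chart P 0 1); last by rewrite vz base_part_chart.
by do 2?split => //=; rewrite vz ?height_part_chart// base_part_chart.
Qed.

Lemma direction_small (r : R) j (t : 'rV[R]_d) : 0 < r ->
  `|t - direction r j| < r / (4 * d%:R) -> enorm t < r.
Proof.
move=> r0 tj; have dR : 0 < d%:R :> R by rewrite ltr0n.
have -> : t = direction r j + (t - direction r j) by rewrite addrC subrK.
rewrite (le_lt_trans (enormD _ _))//.
have -> : enorm (direction r j) = r / 2.
  have e1 : edot (basis_vec j.1) (basis_vec j.1) = 1 :> R.
    rewrite /edot (bigD1 j.1)//= mxE !eqxx mulr1 big1 ?addr0// => i ij.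
    by rewrite mxE (negbTE ij) andbF mul0r.
  rewrite enormZ /enorm e1 sqrtr1 mulr1 normrM normrX normrN1 expr1n mul1r.
  by rewrite gtr0_norm// divr_gt0.
have := enorm_le_norm (t - direction r j).
have : d%:R * `|t - direction r j| < r / 4.
  by rewrite mulrC -ltr_pdivlMr// (_ : r / 4 / d%:R = r / (4 * d%:R))//; field; rewrite gt_eqF.
lra.
Qed.

(** The supporting hyperplane at [w] stays above the ball around [z], which
    limits its slope to [8] and thereby the heights above the ball. *)
Lemma cell_bounds z r t D w v : 0 < r -> eball z r `<=` Omega -> S w ->
  w - z = D *: chart P 0 1 -> 0 < D -> D <= 8 * r ->
  (forall t', `|t' - t| < r / (4 * d%:R) -> enorm t' < r) ->
  cell z r t v ->
  [/\ 0 < height_part P (v - z) <= 16 * r & enorm (v - z) <= 17 * r].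
Proof.
move=> r0 zr Sw wz D0 D8 tr [[Sv h0] /tr base_r].
rewrite /= in h0; set h := height_part P (v - z) in h0 *.
have n1 := enorm_normal body bd_smooth Sw; rewrite -/nrm in n1.
set nt := height_part P (nrm w).
have Dnt : r <= D * nt.
  have := inner_ball_support body bd_smooth zr Sw r0.
  by rewrite -/nrm wz edotZl edotC -(height_part_edot orthP).
have nt0 : 0 < nt by rewrite -(pmulr_rgt0 _ D0) (lt_le_trans r0).
have nt8 : 8^-1 <= nt.
  have : D * nt <= 8 * r * nt by rewrite (ler_pM2r nt0).
  move=> h1; have : r * 8^-1 <= r * nt by lra.
  by rewrite (ler_pM2l r0).
have := normal_supporting body bd_smooth Sw (boundary_mem body Sv).
have -> : v - w = (v - z) - (w - z) by rewrite opprB addrA subrK.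
rewrite -/nrm wz edotBl edotZl (edotC (chart P 0 1)) -(height_part_edot orthP).
rewrite (edot_parts orthP) -/nt -/h.
have := edot_abs_le (base_part P (v - z)) (base_part P (nrm w)).
have nb1 := enorm_base_part orthP (nrm w); rewrite n1 in nb1.
have : enorm (base_part P (v - z)) * enorm (base_part P (nrm w)) <= r.
  rewrite -[leRHS]mulr1 ler_pM ?enorm_ge0//; exact: ltW.
move=> h1 h2 h3; move: (le_trans h2 h1); rewrite ler_norml => /andP[h4 _].
have hD : (h - D) * nt <= r by lra.
have hD8 : h - D <= 8 * r.
  have [hD0|/ltW hD0] := leP (h - D) 0; first by lra.
  have : (h - D) * 8^-1 <= (h - D) * nt by rewrite ler_wpM2l.
  lra.
split; first by rewrite h0; lra.
rewrite (le_trans (enorm_le_parts orthP _))// -/h gtr0_norm//; lra.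
Qed.

End Cells.

(** * Oscillation of the normal *)

Section NormalOscillation.
Context {R : realType} {d : nat}.
Variables c s p Lambda : R.
Hypothesis d0 : (0 < d)%N.
Hypothesis c0 : 0 < c.
Hypothesis s0 : 0 < s.
Hypothesis p0 : 0 < p.
Hypothesis Lambda0 : 0 < Lambda.

Definition cell_mass : R := @cube_constant R d / (8 * d%:R) ^+ d.

(** The bound of [energy_selection] for inner radius [1]: distances are at most
    [34], each cell has mass [cell_mass], and there are [4 d] cells. *)
Definition selection_constant : R := 34 `^ (d%:R + 1 + s) *
  ((2 * Lambda / cell_mass) `^ p^-1 / (c * cell_mass) * (2 * (d * 2))%N.+1%:R).

(** Twice the factor of [normals_close], since two normals are compared with a
    third one. *)
Definition oscillation_constant : R := 512 * d%:R * selection_constant.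

Lemma cell_mass_gt0 : 0 < cell_mass.
Proof.
rewrite divr_gt0 ?cube_constant_gt0// exprn_gt0// mulr_gt0// ltr0n//.
Qed.

Lemma selection_constant_ge0 : 0 <= selection_constant.
Proof.
have k0 := ltW cell_mass_gt0.
by rewrite mulr_ge0 ?powR_ge0// mulr_ge0// divr_ge0 ?powR_ge0// mulr_ge0// ltW.
Qed.

Lemma oscillation_constant_ge0 : 0 <= oscillation_constant.
Proof.
by apply: mulr_ge0 selection_constant_ge0; apply: mulr_ge0; exact: ler0n.
Qed.

(** The powers of [r] are [d + 1 + s] from the distances, [- d] from the mass of a
    cell and [- d / p] from the curvature at the selected points. *)
Lemma selection_scaling (r : R) : 0 < r ->
  (34 * r) `^ (d%:R + 1 + s) *
    ((2 * Lambda / (cell_mass * r ^+ d)) `^ p^-1 / (c * (cell_mass * r ^+ d)) *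
     (2 * (d * 2))%N.+1%:R) =
  selection_constant * r `^ (s - d%:R / p) * r.
Proof.
move=> r0; have k0 := cell_mass_gt0; set k := cell_mass in k0 *.
have rd : r ^+ d = r `^ d%:R by rewrite powR_mulrn// ltW.
have rN x : r `^ x != 0 by rewrite gt_eqF// powR_gt0.
have E1 : (34 * r) `^ (d%:R + 1 + s) =
    34 `^ (d%:R + 1 + s) * (r `^ d%:R * r * r `^ s).
  rewrite powRM ?ltW//; congr (_ * _).
  rewrite powRD; last by rewrite (gt_eqF r0) implybT.
  by rewrite powRD ?(gt_eqF r0) ?implybT// powRr1// ltW.
have E2 : (2 * Lambda / (k * r ^+ d)) `^ p^-1 =
    (2 * Lambda / k) `^ p^-1 * r `^ (- (d%:R / p)).
  rewrite rd -mulNr powRrM -powRM ?powR_ge0//; last first.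
    by rewrite ltW// divr_gt0// mulr_gt0.
  by congr (_ `^ _); rewrite powRN; field; rewrite rN gt_eqF.
rewrite E1 E2 rd powRD; last by rewrite (gt_eqF r0) implybT.
rewrite /selection_constant -/k.
field.
by rewrite rN !gt_eqF.
Qed.

Variable Omega : set 'rV[R]_(d + 1).
Hypothesis body : convex_body Omega.
Hypothesis bd_smooth : smooth_boundary Omega.
Hypothesis energy : (fractional_willmore c s p Omega <= Lambda%:E)%E.
Let S := boundary Omega.
Let nrm := outward_normal Omega.

(** Seen from [z], cells in all directions around [w1] and [w2] are confronted
    with the tangent hyperplane at a point [y] of one further cell; the normals
    at [w1] and [w2] are both close to the one at [y]. *)
Lemma normal_oscillation (z w1 w2 : 'rV[R]_(d + 1)) (r : R) :
  0 < r -> eball z r `<=` Omega -> S w1 -> S w2 ->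
  enorm (w1 - z) <= 8 * r -> enorm (w2 - z) <= 8 * r ->
  enorm (nrm w1 - nrm w2) <= oscillation_constant * r `^ (s - d%:R / p).
Proof.
move=> r0 zr Sw1 Sw2 w1z w2z.
have dR : 0 < d%:R :> R by rewrite ltr0n.
pose w b := if b then w1 else w2.
have Sw b : S (w b) by case: b.
have wz b : enorm (w b - z) <= 8 * r by case: b.
pose D b := enorm (w b - z).
have D0 b : 0 < D b.
  exact: lt_le_trans r0 (inner_ball_dist body bd_smooth zr (Sw b) r0).
have axis b : exists P : 'M[R]_(d + 1),
    special_orthogonal P /\ w b - z = D b *: chart P 0 1.
  have u1 : enorm ((D b)^-1 *: (w b - z)) = 1.
    by rewrite enormZ gtr0_norm ?invr_gt0// mulVf// gt_eqF ?D0.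
  have [P oP PE] := rotation_to_axis d0 u1; exists P; split=> //.
  by rewrite PE scalerA divff ?scale1r// gt_eqF ?D0.
have [P PP] := choice axis.
have orthP b : P b *m (P b)^T = 1%:M by have [[]] := PP b.
have wE b : w b - z = D b *: chart (P b) 0 1 by have [] := PP b.
pose Q (i : bool * ('I_d * bool)) := cell Omega (P i.1) z r (direction r i.2).
pose Q0 := cell Omega (P true) z r 0.
pose m := cell_mass * r ^+ d.
have mE : @cube_constant R d * (r / (8 * d%:R)) ^+ d = m.
  by rewrite /m /cell_mass exprMn exprVn; ring.
have m0 : 0 < m by rewrite mulr_gt0 ?cell_mass_gt0// exprn_gt0.
have small0 (t' : 'rV[R]_d) : `|t' - 0| < r / (4 * d%:R) -> enorm t' < r.
  rewrite subr0 ltr_pdivlMr ?mulr_gt0// => t'a.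
  by have := enorm_le_norm t'; have := enorm_ge0 t'; lra.
have smallj j (t' : 'rV[R]_d) : `|t' - direction r j| < r / (4 * d%:R) -> enorm t' < r.
  exact: direction_small.
have far b t v (h : forall t', `|t' - t| < r / (4 * d%:R) -> enorm t' < r) :=
  cell_bounds body bd_smooth (orthP b) (v := v) r0 zr (Sw b) (wE b) (D0 b) (wz b) h.
set M := selection_constant * r `^ (s - d%:R / p) * r.
have M0 : 0 <= M.
  by rewrite mulr_ge0 ?(ltW r0)// mulr_ge0 ?powR_ge0 ?selection_constant_ge0.
have goalE : oscillation_constant * r `^ (s - d%:R / p) = 512 * d%:R * M / r.
  by rewrite /oscillation_constant /M; field; rewrite gt_eqF.
rewrite goalE.
have n1 b := enorm_normal body bd_smooth (Sw b).
(* For large [M] the estimate is trivial, the normals being unit vectors. *)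
have [Mr|Mr] := leP M (r / 2); last first.
  apply: (@le_trans _ _ 2).
    by rewrite (le_trans (enormB _ _))// (n1 true) (n1 false).
  rewrite ler_pdivlMr//.
  have : r / 2 <= d%:R * M.
    by rewrite (le_trans (ltW Mr))// ler_peMl// ler1n.
  lra.
have supp u v : S u -> S v -> edot (u - v) (nrm v) <= 0.
  by move=> Su Sv; apply: normal_supporting => //; exact: boundary_mem.
have QS i : Q i `<=` S by move=> v [[]].
have Q0S : Q0 `<=` S by move=> v [[]].
have cQ i : (@hausdorff_outer R (d + 1) d).-caratheodory (Q i).
  exact: (cell_caratheodory _ (orthP i.1)).
have cQ0 : (@hausdorff_outer R (d + 1) d).-caratheodory Q0.
  exact: (cell_caratheodory _ (orthP true)).
have Qm i : (m%:E <= hausdorff_outer d (Q i))%E.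
  by rewrite -mE; apply: (cell_measure d0 body (orthP i.1) r0 zr (smallj _)).
have Q0m : (m%:E <= hausdorff_outer d Q0)%E.
  by rewrite -mE; apply: (cell_measure d0 body (orthP true) r0 zr small0).
have L0 : 0 < 34 * r by rewrite mulr_gt0.
have QL i u v : Q i u -> Q0 v -> enorm (u - v) <= 34 * r.
  move=> /(far _ _ _ (smallj _))[_ uz] /(far _ _ _ small0)[_ vz].
  by have := enorm_dist_trans z u v; rewrite (enormC z v); lra.
have [x [y [xQ yQ0 xyM]]] := energy_selection supp
  (normal_continuous body bd_smooth) c0 (ltW s0) p0 Lambda0 m0 L0 energy
  QS Q0S cQ cQ0 Qm Q0m QL.
have {}xyM i : edot (y - x i) (nrm y) <= M.
  have := xyM i; rewrite card_prod card_prod card_ord card_bool.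
  by rewrite (natr1 (2 * (d * 2))) selection_scaling.
have Sy : S y := Q0S _ yQ0.
have ynz : r <= edot (y - z) (nrm y).
  exact: (inner_ball_support body bd_smooth zr Sy r0).
have close b : enorm (nrm (w b) - nrm y) <= 256 * d%:R * M / r.
  apply: (normals_close (x := fun j => x (b, j)) d0 (orthP b) r0 M0 Mr (n1 b) _ (wE b) (D0 b)).
  - exact: (enorm_normal body bd_smooth Sy).
  - exact: (inner_ball_support body bd_smooth zr (Sw b) r0).
  - by move=> j; apply: supp => //; apply: QS (xQ (b, j)).
  - move=> j; have := xyM (b, j); have := supp _ _ (Sw b) Sy.
    by rewrite !edotBl; lra.
  - by move=> j; have := xyM (b, j); move: ynz; rewrite !edotBl; lra.
  - move=> j k; have [_ /= xj] := xQ (b, j).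
    have := coord_le_norm (base_part (P b) (x (b, j) - z) - direction r j) k.
    by rewrite !mxE => /le_trans; apply; exact: ltW.
  - by move=> j; have [] := far _ _ _ (smallj _) (xQ (b, j)).
have twice : 512 * d%:R * M / r = 256 * d%:R * M / r + 256 * d%:R * M / r.
  by clear; ring.
rewrite twice; apply: (le_trans (enorm_dist_trans (nrm y) _ _)).
by apply: lerD; [exact: (close true)|rewrite enormC; exact: (close false)].
Qed.

End NormalOscillation.

(** * Inner balls of uniform size *)

Lemma small_power (R : realType) (C alpha e : R) : 0 < alpha -> 0 < e -> 0 <= C ->
  exists2 rho, 0 < rho & forall r, 0 < r -> r <= rho -> C * r `^ alpha <= e.
Proof.
move=> a0 e0 C0; have C1 : 0 < C + 1 by lra.
exists ((e / (C + 1)) `^ alpha^-1); first by rewrite powR_gt0// divr_gt0.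
move=> r r0 rr; apply: (@le_trans _ _ ((C + 1) * (e / (C + 1)))).
  rewrite ler_pM ?powR_ge0//; first by lra.
  have -> : e / (C + 1) = ((e / (C + 1)) `^ alpha^-1) `^ alpha.
    by rewrite -powRrM (mulVf (lt0r_neq0 a0)) powRr1// (ltW (divr_gt0 e0 C1)).
  by rewrite ge0_ler_powR// ?nnegrE ?powR_ge0 ?(ltW r0) ?(ltW a0).
by rewrite [leLHS]mulrC divfK ?gt_eqF.
Qed.

Lemma outside_point_absurd (R : realType) n (x0 q w v nw nu : 'rV[R]_n) (t h k : R) :
  0 < t -> 0 <= h -> enorm (x0 - q) <= 4 * t -> t <= edot (x0 - q) nu ->
  enorm (nw - nu) <= 8^-1 -> edot (x0 - w) nw <= 0 -> t <= h * edot v nw ->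
  0 <= k -> q - w = k *: v -> False.
Proof.
move=> t0 h0 x0q x0q_nu nwnu supw inw k0 qwE.
have vn : 0 <= edot v nw.
  rewrite leNgt; apply/negP => vn; have : h * edot v nw <= 0.
    by apply: mulr_ge0_le0 => //; exact: ltW.
  lra.
have qw : 0 <= edot (q - w) nw by rewrite qwE edotZl mulr_ge0.
have : edot (x0 - q) nw <= 0.
  have -> : x0 - q = (x0 - w) - (q - w) by rewrite opprB addrA subrK.
  by rewrite edotBl; lra.
have -> : edot (x0 - q) nw = edot (x0 - q) nu + edot (x0 - q) (nw - nu).
  by rewrite edotBr; ring.
have := edot_abs_le (x0 - q) (nw - nu); rewrite ler_norml => /andP[h1 _].
have h2 : enorm (x0 - q) * enorm (nw - nu) <= 4 * t * 8^-1.
  by rewrite ler_pM ?enorm_ge0.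
lra.
Qed.

Section InnerBalls.
Context {R : realType} {n : nat}.
Variable Omega : set 'rV[R]_n.
Hypothesis body : convex_body Omega.
Hypothesis bd_smooth : smooth_boundary Omega.
Let S := boundary Omega.
Let nrm := outward_normal Omega.

(** The centre of a tangent ball would be at distance [t]; the factor [2] leaves
    the room that allows inner balls to grow. *)
Definition inner_ball (x0 : 'rV[R]_n) (t : R) : Prop :=
  exists2 z, eball z t `<=` Omega & enorm (z - x0) <= 2 * t.

Lemma inner_ball_shrink x0 t r : Omega x0 -> 0 < r -> r <= t ->
  inner_ball x0 t -> inner_ball x0 r.
Proof.
move=> Ox0 r0 rt [z zt zx0]; have t0 := lt_le_trans r0 rt.
have rt0 : 0 < r / t by rewrite divr_gt0.
have rt1 : r / t <= 1 by rewrite ler_pdivrMr// mul1r.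
exists (x0 + (r / t) *: (z - x0)); last first.
  rewrite addrAC subrr add0r enormZ gtr0_norm// mulrAC ler_pdivrMr//.
  rewrite mulrC mulrAC; by rewrite (ler_pM2r r0).
move=> y yr.
pose y0 := x0 + (t / r) *: (y - x0).
have -> : y = (r / t) *: y0 + (1 - r / t) *: x0.
  apply/rowP => i; rewrite /y0 !mxE; field.
  by rewrite !gt_eqF.
apply: body_convex => //; last exact: ltW.
apply: zt; rewrite /eball/=.
have -> : y0 - z = (t / r) *: (y - (x0 + (r / t) *: (z - x0))).
  apply/rowP => i; rewrite /y0 !mxE; field.
  by rewrite !gt_eqF.
rewrite enormZ gtr0_norm ?divr_gt0// mulrAC ltr_pdivrMr// (ltr_pM2l t0).
exact: yr.
Qed.

(** If the normal hardly turns at scale [t], then [Omega] looks like a half-space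
    in the ball of radius [4 t] around [x0], which therefore contains an inner
    ball larger than [t]: a segment leaving [Omega] on the way from [z] to a
    point [q] of that half-space would meet the boundary at a point where the
    normal points away from the one at [x0]. *)
Lemma inner_ball_growth x0 z t : 0 < t -> S x0 -> eball z t `<=` Omega ->
  enorm (z - x0) <= 2 * t ->
  (forall w, S w -> enorm (w - z) <= 8 * t -> enorm (nrm w - nrm x0) <= 8^-1) ->
  eball (x0 - (5 / 2 * t) *: nrm x0) (3 / 2 * t) `<=` Omega.
Proof.
move=> t0 Sx0 zt zx0 osc q qball.
have nu1 := enorm_normal body bd_smooth Sx0; rewrite -/nrm in nu1.
apply: contrapT => nOq.
have Oz : Omega z by apply: zt; exact: eball_center.
have qz0 : 0 < enorm (q - z).
  rewrite lt_def enorm_ge0 andbT enorm_eq0 subr_eq0.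
  by apply/eqP => qz; apply: nOq; rewrite qz.
set u := x0 - (5 / 2 * t) *: nrm x0 - q.
have ut : enorm u < 3 / 2 * t by rewrite /u enormC.
have x0q : x0 - q = u + (5 / 2 * t) *: nrm x0.
  by apply/rowP => i; rewrite /u !mxE; ring.
have x0q_le : enorm (x0 - q) <= 4 * t.
  rewrite x0q (le_trans (enormD _ _))// enormZ nu1 gtr0_norm ?mulr_gt0//; lra.
have x0q_nu : t <= edot (x0 - q) (nrm x0).
  rewrite x0q edotDl edotZl -enorm2 nu1 expr1n mulr1.
  have := edot_abs_le u (nrm x0); rewrite nu1 mulr1 ler_norml => /andP[h _]; lra.
pose L := enorm (q - z); pose v := L^-1 *: (q - z).
have v1 : enorm v = 1 by rewrite enormZ gtr0_norm ?invr_gt0// mulVf// gt_eqF.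
have qE : q = z + L *: v.
  by rewrite /v scalerA divff ?gt_eqF// scale1r addrC subrK.
have [|h Sh hmax] := line_top body (u := z) v1; first by exists 0; rewrite scale0r addr0.
set w := z + h *: v in Sh.
have h0 : 0 <= h by apply: hmax; rewrite scale0r addr0.
have hL : h <= L.
  rewrite leNgt; apply/negP => Lh; apply: nOq; rewrite qE.
  have hp : 0 < h := lt_trans qz0 Lh.
  have -> : z + L *: v = (L / h) *: w + (1 - L / h) *: z.
    have key (a b : 'rV[R]_n) (k m : R) : m != 0 ->
        a + k *: b = (k / m) *: (a + m *: b) + (1 - k / m) *: a.
      by move=> m0; apply/rowP => i; rewrite !mxE; field.
    by apply: key; rewrite gt_eqF.
  apply: body_convex => //; first exact: (boundary_mem body).
    by rewrite divr_ge0// enorm_ge0.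
  by rewrite ler_pdivrMr// mul1r ltW.
have L6 : L <= 6 * t.
  have := enorm_dist_trans x0 q z; rewrite -/L (enormC q) (enormC x0 z); lra.
have wz : w - z = h *: v by rewrite /w addrC addKr.
have wz8 : enorm (w - z) <= 8 * t by rewrite wz enormZ v1 mulr1 ger0_norm//; lra.
have nw := osc w Sh wz8.
have supw := normal_supporting body bd_smooth Sh (boundary_mem body Sx0).
have inw := inner_ball_support body bd_smooth zt Sh t0.
rewrite -/nrm in supw inw.
rewrite wz edotZl in inw.
apply: (outside_point_absurd t0 h0 x0q_le x0q_nu nw supw inw (k := L - h)).
  by rewrite subr_ge0.
by rewrite {1}qE /w scalerBl opprD addrACA subrr add0r.
Qed.

(** Below [rho] the radius of an inner ball can be multiplied by [3/2], so that
    a radius beyond [r] is reached from an arbitrarily small one; a homothety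
    centred at [x0] reduces it to [r]. *)
Lemma inner_ball_all_scales x0 rho : S x0 ->
  (forall z t w, 0 < t -> t <= rho -> eball z t `<=` Omega ->
     enorm (z - x0) <= 2 * t -> S w -> enorm (w - z) <= 8 * t ->
     enorm (nrm w - nrm x0) <= 8^-1) ->
  forall r, 0 < r -> r <= rho -> inner_ball x0 r.
Proof.
move=> Sx0 osc r r0 rrho; have Ox0 := boundary_mem body Sx0.
have [t0 [z0 [t00 z0t0 z0x0]]] := interior_ball_near_boundary body bd_smooth Sx0.
have step k : exists t, [/\ 0 < t, inner_ball x0 t & r <= t \/ (3 / 2) ^+ k * t0 <= t].
  elim: k => [|k [t [tp [z zt zx] [rt|kt]]]].
  - by exists t0; split=> //; [exists z0|right; rewrite expr0 mul1r].
  - by exists t; split=> //; [exists z|left].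
  have [rt|tr] := leP r t; first by exists t; split=> //; [exists z|left].
  exists (3 / 2 * t); split; first by rewrite mulr_gt0.
    exists (x0 - (5 / 2 * t) *: nrm x0).
      apply: (inner_ball_growth tp Sx0 zt zx) => w Sw wz.
      by apply: (osc z t) => //; rewrite (le_trans (ltW tr)).
    rewrite addrAC subrr add0r enormN enormZ (enorm_normal body bd_smooth Sx0).
    rewrite mulr1 gtr0_norm ?mulr_gt0//; lra.
  by right; rewrite exprS -mulrA ler_pM2l.
have bern k : 1 + k%:R / 2 <= (3 / 2) ^+ k :> R.
  elim: k => [|k ih]; first by rewrite expr0 mul0r addr0.
  rewrite exprS -natr1; have : 0 <= k%:R :> R by []; lra.
have [t [tp it rt]] := step (Num.bound (2 * (r / t0))).
apply: (inner_ball_shrink Ox0 r0 _ it); case: rt => // /(le_trans _); apply.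
rewrite -ler_pdivrMr//.
have := archi_boundP (_ : 0 <= 2 * (r / t0)).
have h0 : 0 <= 2 * (r / t0) by rewrite mulr_ge0// divr_ge0// ltW.
move=> /(_ h0); have := bern (Num.bound (2 * (r / t0))); lra.
Qed.

End InnerBalls.

(** * Smooth solutions of first-order systems *)

Section Pullback.
Context {R : realType} {n m : nat}.
Variables (Phi : 'rV[R]_n -> 'rV[R]_m) (B : set 'rV[R]_n) (U : set 'rV[R]_m).

(** If the partial derivatives of [Phi] belong to this algebra, that is, if [Phi]
    solves a first-order system with smooth coefficients, then the chain rule makes
    the algebra stable under partial derivatives, and all its members are smooth. *)
Inductive pullback : ('rV[R]_n -> R) -> Prop :=
| pullback_comp G : smooth_on U G -> pullback (G \o Phi)
| pullback_add g h : pullback g -> pullback h -> pullback (fun x => g x + h x)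
| pullback_mul g h : pullback g -> pullback h -> pullback (fun x => g x * h x)
| pullback_inv g : pullback g -> (forall x, B x -> g x != 0) ->
    pullback (fun x => (g x)^-1).

Lemma smooth_cst (V : set 'rV[R]_m) (a : R) : open V -> smooth_on V (cst a).
Proof.
move=> oV; pose F (g : 'rV[R]_m -> R) := exists a, g = cst a.
apply: (@smooth_coind _ _ _ V F) => //; last by exists a.
  by move=> _ [b ->] x _; exact: cst_continuous.
move=> _ [b ->] i; exists (cst 0); first by exists 0.
by move=> x _; exact: is_derive_cst.
Qed.

Hypothesis oU : open U.

Lemma pullback_cst a : pullback (fun=> a).
Proof. exact: (pullback_comp (smooth_cst a oU)). Qed.

Lemma pullback_sum (I : finType) (g : I -> 'rV[R]_n -> R) :
  (forall i, pullback (g i)) -> pullback (fun x => \sum_i g i x).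
Proof.
move=> pg; elim: (index_enum I) => [|i r ih].
  rewrite (_ : (fun x => _) = fun=> 0); first exact: pullback_cst.
  by apply/funext => x; rewrite big_nil.
rewrite (_ : (fun x => _) = fun x => g i x + \sum_(j <- r) g j x).
  exact: pullback_add.
by apply/funext => x; rewrite big_cons.
Qed.

Variable dPhi : 'I_n -> 'rV[R]_n -> 'rV[R]_m.
Hypothesis Phi_U : forall x, B x -> U (Phi x).
Hypothesis Phi_diff : forall x, B x -> differentiable Phi x.
Hypothesis Phi_derive : forall x i, B x -> is_derive x (basis_vec i) Phi (dPhi i x).
Hypothesis dPhi_pullback : forall i k, pullback (fun x => dPhi i x 0 k).

Lemma pullback_continuous g x : pullback g -> B x -> {for x, continuous g}.
Proof.
move=> pg Bx; elim: pg => {g} [G sG|g h _ gc _ hc|g h _ gc _ hc|g _ gc g0].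
- apply: continuous_comp; first exact: differentiable_continuous (Phi_diff Bx).
  exact: smooth_continuous sG (Phi_U Bx).
- exact: continuousD.
- exact: continuousM.
- by apply: continuousV => //; exact: g0.
Qed.

Lemma pullback_derive g : pullback g -> forall i, exists2 g', pullback g' &
  forall x, B x -> is_derive x (basis_vec i) g (g' x).
Proof.
elim=> {g} [G sG|g h pg dg ph dh|g h pg dg ph dh|g pg dg g0] i.
- exists (fun x => \sum_k dPhi i x 0 k * 'D_(basis_vec k) G (Phi x)).
    apply: pullback_sum => k; apply: pullback_mul => //.
    exact: (pullback_comp (smooth_partial k sG)).
  move=> x Bx; have dP := Phi_derive i Bx; have fP := Phi_diff Bx.
  have [fG DG] := smooth_differentiable oU sG (Phi_U Bx).
  have fGP : differentiable (G \o Phi) x by exact: differentiable_comp.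
  apply: DeriveDef; first exact: diff_derivable.
  rewrite deriveE// diff_comp//= -deriveE// DG -deriveE//.
  rewrite (@derive_val _ _ _ _ _ _ _ dP).
  by apply: eq_bigr => k _; rewrite mxE.
- have [g' pg' g'P] := dg i; have [h' ph' h'P] := dh i.
  exists (fun x => g' x + h' x); first exact: pullback_add.
  by move=> x Bx; exact: (is_deriveD (g'P x Bx) (h'P x Bx)).
- have [g' pg' g'P] := dg i; have [h' ph' h'P] := dh i.
  exists (fun x => g x * h' x + h x * g' x).
    by apply: pullback_add; apply: pullback_mul.
  by move=> x Bx; exact: (is_deriveM (g'P x Bx) (h'P x Bx)).
- have [g' pg' g'P] := dg i.
  exists (fun x => (-1) * ((g x)^-1 * (g x)^-1) * g' x).
    do ?apply: pullback_mul => //; first exact: pullback_cst.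
      exact: pullback_inv.
    exact: pullback_inv.
  move=> x Bx; have dgx := g'P x Bx.
  apply: DeriveDef.
    by apply: derivableV; [exact: g0|exact: (@ex_derive _ _ _ _ _ _ _ dgx)].
  rewrite deriveV; [|exact: g0|exact: (@ex_derive _ _ _ _ _ _ _ dgx)].
  rewrite (@derive_val _ _ _ _ _ _ _ dgx).
  by rewrite -exprVn expr2 mulN1r.
Qed.

Lemma smooth_of_pullback_partials (f : 'rV[R]_n -> R) :
  open B -> (forall x, B x -> {for x, continuous f}) ->
  (forall i, exists2 g, pullback g &
     forall x, B x -> is_derive x (basis_vec i) f (g x)) ->
  smooth_on B f.
Proof.
move=> oB fc fd; apply: (@smooth_coind _ _ _ B (fun g => pullback g \/ g = f)) => //.
- by move=> g [pg x|->]; [exact: pullback_continuous|exact: fc].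
- move=> g [pg|->] i.
    by have [g' pg' g'P] := pullback_derive pg i; exists g' => //; left.
  by have [g' pg' g'P] := fd i; exists g' => //; left.
- by right.
Qed.

End Pullback.

(** * The boundary as a graph *)

Lemma coord_dist_le_enorm (R : realType) n (u v : 'rV[R]_n) i :
  `|u 0 i - v 0 i| <= enorm (u - v).
Proof. by have := coord_le_enorm (u - v) i; rewrite !mxE. Qed.

Section Slopes.
Context {R : realType} {d : nat}.
Variable P : 'M[R]_(d + 1).
Hypothesis orthP : P *m P^T = 1%:M.
Implicit Types u v : 'rV[R]_(d + 1).

(** Gradient, in the coordinates of [P], of a function whose graph is orthogonal
    to [u]. *)
Definition slope u : 'rV[R]_d := - ((height_part P u)^-1 *: base_part P u).

Lemma slopeZ a u : a != 0 -> slope (a *: u) = slope u.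
Proof.
move=> a0; rewrite /slope height_partZ base_partZ scalerA invfM.
by rewrite mulrAC mulVf// mul1r.
Qed.

Lemma near_axis u : enorm (u - chart P 0 1) <= 8^-1 ->
  7 / 8 <= height_part P u /\ enorm (base_part P u) <= 8^-1.
Proof.
set a := chart P 0 1 => ua; split.
  have h : height_part P (u - a) = height_part P u - 1.
    by rewrite height_partB height_part_chart.
  have := le_trans (height_part_le orthP (u - a)) ua.
  rewrite h ler_norml => /andP[h1 _]; lra.
have -> : base_part P u = base_part P (u - a).
  by rewrite base_partB base_part_chart// subr0.
exact: le_trans (enorm_base_part orthP _) ua.
Qed.

Lemma slope_dist_le u v :
  enorm (u - chart P 0 1) <= 8^-1 -> enorm (v - chart P 0 1) <= 8^-1 ->
  enorm (slope u - slope v) <= 2 * enorm (u - v).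
Proof.
move=> /near_axis[hu bu] /near_axis[hv bv].
set a := height_part P u in hu *; set b := height_part P v in hv *.
have a0 : 0 < a by lra. have b0 : 0 < b by lra.
have -> : slope u - slope v =
    a^-1 *: base_part P (v - u) + (a^-1 * b^-1 * (a - b)) *: base_part P v.
  rewrite /slope -/a -/b base_partB; apply/rowP => i; rewrite !mxE; field.
  by rewrite !gt_eqF.
rewrite (le_trans (enormD _ _))// !enormZ normrM (gtr0_norm (_ : 0 < a^-1)) ?invr_gt0//.
rewrite (gtr0_norm (_ : 0 < a^-1 * b^-1)) ?mulr_gt0 ?invr_gt0//.
have ai : a^-1 <= 8 / 7 by rewrite -[8 / 7]invf_div lef_pV2 ?posrE.
have bi : b^-1 <= 8 / 7 by rewrite -[8 / 7]invf_div lef_pV2 ?posrE.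
have ai0 : 0 <= a^-1 by rewrite invr_ge0 ltW.
have bi0 : 0 <= b^-1 by rewrite invr_ge0 ltW.
have h1 : enorm (base_part P (v - u)) <= enorm (u - v).
  by rewrite enormC; exact: enorm_base_part.
have h2 : `|a - b| <= enorm (u - v).
  by rewrite /a /b -height_partB; exact: height_part_le.
have e1 : a^-1 * enorm (base_part P (v - u)) <= 8 / 7 * enorm (u - v).
  by rewrite ler_pM ?enorm_ge0.
have e2 : a^-1 * b^-1 <= 8 / 7 * (8 / 7) by rewrite ler_pM.
have e3 : a^-1 * b^-1 * `|a - b| <= 8 / 7 * (8 / 7) * enorm (u - v).
  by rewrite ler_pM// mulr_ge0.
have e4 : a^-1 * b^-1 * `|a - b| * enorm (base_part P v) <=
    8 / 7 * (8 / 7) * enorm (u - v) * 8^-1.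
  by rewrite ler_pM ?enorm_ge0// mulr_ge0// mulr_ge0.
have := enorm_ge0 (u - v); lra.
Qed.

Lemma slope_small u : enorm (u - chart P 0 1) <= 8^-1 -> enorm (slope u) <= 1.
Proof.
move=> /near_axis[hu bu]; have h0 : 0 < height_part P u by lra.
rewrite /slope enormN enormZ gtr0_norm ?invr_gt0//.
by rewrite mulrC ler_pdivrMr//; lra.
Qed.

End Slopes.

Lemma quotient_between (R : realType) (h a b k e : R) : h != 0 ->
  k <= h * a -> h * b <= k -> `|b - a| <= e -> `|a - h^-1 * k| <= e.
Proof.
move=> h0 ka kb ab; have hp : 0 < `|h| by rewrite normr_gt0.
rewrite -(ler_pM2l hp) -normrM mulrBr mulVKf//.
have -> : `|h * a - k| = h * a - k by rewrite ger0_norm// subr_ge0.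
apply: (@le_trans _ _ (`|h| * `|b - a|)); last by rewrite ler_pM2l.
rewrite -normrM -normrN -mulrN opprB mulrBr (le_trans _ (ler_norm _))//.
lra.
Qed.

Section ConvexGraph.
Context {R : realType} {d : nat}.
Hypothesis d0 : (0 < d)%N.
Variable Omega : set 'rV[R]_(d + 1).
Hypothesis body : convex_body Omega.
Hypothesis bd_smooth : smooth_boundary Omega.
Let S := boundary Omega.
Let nrm := outward_normal Omega.
Variables (C alpha rho : R).
Hypothesis C0 : 0 <= C.
Hypothesis alpha0 : 0 < alpha.
Hypothesis rho0 : 0 < rho.
Hypothesis osc : forall z w1 w2 r, 0 < r -> eball z r `<=` Omega -> S w1 -> S w2 ->
  enorm (w1 - z) <= 8 * r -> enorm (w2 - z) <= 8 * r ->
  enorm (nrm w1 - nrm w2) <= C * r `^ alpha.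
Hypothesis scale : forall r, 0 < r -> r <= rho -> C * r `^ alpha <= 8^-1.

Lemma inner_balls x0 r : S x0 -> 0 < r -> r <= rho -> inner_ball Omega x0 r.
Proof.
move=> Sx0 r0 rr; apply: (inner_ball_all_scales body bd_smooth Sx0 _ r0 rr).
move=> z t w t0 tr zt zx0 Sw wz; apply: le_trans (scale t0 tr).
apply: (osc t0 zt) => //; rewrite enormC (le_trans zx0)//; lra.
Qed.

Variables (x0 : 'rV[R]_(d + 1)) (P : 'M[R]_(d + 1)).
Hypothesis Sx0 : S x0.
Hypothesis orthP : P *m P^T = 1%:M.
Hypothesis PE : chart P 0 1 = nrm x0.

Lemma bottom_ball :
  eball (x0 - (5 / 2 * rho) *: chart P 0 1) (3 / 2 * rho) `<=` Omega.
Proof.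
have [z zr zx0] := inner_balls Sx0 rho0 (lexx rho).
rewrite PE; apply: (inner_ball_growth body bd_smooth rho0 Sx0 zr zx0) => w Sw wz.
apply: le_trans (scale rho0 (lexx rho)).
apply: (osc rho0 zr) => //; rewrite enormC (le_trans zx0)//.
by have := rho0; lra.
Qed.

Lemma bottom_mem x : enorm x < 3 / 2 * rho ->
  Omega (x0 + chart P x (- (5 / 2 * rho))).
Proof.
move=> xr; apply: bottom_ball; rewrite /eball/=.
have -> : x0 + chart P x (- (5 / 2 * rho)) - (x0 - (5 / 2 * rho) *: chart P 0 1) =
    chart P x 0.
  by rewrite chart_split scaleNr addrA opprB addrA subrK addrAC subrr add0r.
by rewrite enorm_chart_base.
Qed.

Lemma graph_function_exists : exists f : 'rV[R]_d -> R, forall x,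
  enorm x < 3 / 2 * rho -> S (x0 + chart P x (f x)) /\
    forall h, Omega (x0 + chart P x h) -> h <= f x.
Proof.
suff top x : exists h, enorm x < 3 / 2 * rho -> S (x0 + chart P x h) /\
    forall h', Omega (x0 + chart P x h') -> h' <= h.
  by have [f fP] := choice top; exists f.
have [xr|] := boolP (enorm x < 3 / 2 * rho); last by exists 0.
have pt h : x0 + chart P x h = x0 + chart P x 0 + h *: chart P 0 1.
  by rewrite chart_split addrA.
have [||h Sh hmax] := line_top body (u := x0 + chart P x 0) (v := chart P 0 1).
- exact: enorm_chart_axis.
- by exists (- (5 / 2 * rho)); rewrite -pt; exact: bottom_mem.
by exists h => _; rewrite pt; split => // h'; rewrite pt; exact: hmax.
Qed.

Variable f : 'rV[R]_d -> R.
Hypothesis fP : forall x, enorm x < 3 / 2 * rho -> S (x0 + chart P x (f x)) /\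
    forall h, Omega (x0 + chart P x h) -> h <= f x.
Let Phi x := x0 + chart P x (f x).
Let sl x := slope P (nrm (Phi x)).

Lemma domain_lt (x : 'rV[R]_d) : enorm x < rho -> enorm x < 3 / 2 * rho.
Proof. by have := rho0; lra. Qed.

Lemma graph_boundary x : enorm x < rho -> S (Phi x).
Proof. by move=> /domain_lt /fP[]. Qed.

Lemma graph_bounds x : enorm x < rho -> - (5 / 2 * rho) <= f x <= 0.
Proof.
move=> xr; have [Sx fmax] := fP (domain_lt xr).
rewrite fmax/=; last exact: bottom_mem (domain_lt xr).
have := normal_supporting body bd_smooth Sx0 (boundary_mem body Sx).
rewrite -/nrm -PE addrAC subrr add0r -(height_part_edot orthP).
by rewrite height_part_chart.
Qed.

Lemma graph0 : f 0 = 0.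
Proof.
have zr : enorm (0 : 'rV[R]_d) < rho by rewrite enorm0.
have /andP[_ f0] := graph_bounds zr.
apply/le_anti; rewrite f0; have [_ fmax] := fP (domain_lt zr).
by apply: fmax; rewrite chart0 addr0; exact: (boundary_mem body).
Qed.

Lemma graph_normal x : enorm x < rho ->
  enorm (nrm (Phi x) - chart P 0 1) <= 8^-1.
Proof.
move=> xr; have [z zr zx0] := inner_balls Sx0 rho0 (lexx rho).
rewrite PE; apply: le_trans (scale rho0 (lexx rho)).
apply: (osc rho0 zr) => //; first exact: graph_boundary.
  apply: (le_trans (enorm_dist_trans x0 _ _)); rewrite (enormC x0).
  have -> : Phi x - x0 = chart P x (f x) by rewrite /Phi addrAC subrr add0r.
  have := enorm_le_parts orthP (chart P x (f x)).
  rewrite base_part_chart// height_part_chart//.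
  have /andP[f1 f2] := graph_bounds xr.
  have : `|f x| <= 5 / 2 * rho by rewrite ler_norml f1 (le_trans f2)// mulr_ge0// ltW.
  have := rho0; lra.
by rewrite enormC (le_trans zx0)//; have := rho0; lra.
Qed.

Lemma graph_support x y : enorm x < rho -> enorm y < rho ->
  f y - f x <= edot (y - x) (sl x).
Proof.
move=> xr yr; have Sx := graph_boundary xr.
have [hx _] := near_axis orthP (graph_normal xr).
have := normal_supporting body bd_smooth Sx (boundary_mem body (graph_boundary yr)).
have -> : Phi y - Phi x = chart P (y - x) (f y - f x).
  rewrite /Phi opprD addrACA subrr add0r.
  by rewrite -scaleN1r -chart_scale -chart_add scaleN1r mulN1r.
rewrite (edot_parts orthP) base_part_chart// height_part_chart//.
rewrite /sl /slope -/nrm; set a := height_part P _ in hx *; set b := base_part P _.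
have a0 : 0 < a by lra.
rewrite edotNr edotZr; set A := edot _ b => h.
rewrite -(ler_pM2l a0) mulrN mulrA divff ?gt_eqF// mul1r; lra.
Qed.

Lemma graph_lipschitz x y : enorm x < rho -> enorm y < rho ->
  `|f y - f x| <= enorm (y - x).
Proof.
have main u v : enorm u < rho -> enorm v < rho -> f v - f u <= enorm (v - u).
  move=> ur vr; apply: (le_trans (graph_support ur vr)).
  rewrite (le_trans (edot_le _ _))// ler_piMr ?enorm_ge0//.
  exact: (slope_small orthP (graph_normal ur)).
move=> xr yr; rewrite ler_norml main// andbT lerNl opprB enormC.
exact: main.
Qed.

Lemma graph_dist x y : enorm x < rho -> enorm y < rho ->
  enorm (Phi y - Phi x) <= 2 * enorm (y - x).
Proof.
move=> xr yr.
have -> : Phi y - Phi x = chart P (y - x) (f y - f x).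
  rewrite /Phi opprD addrACA subrr add0r.
  by rewrite -scaleN1r -chart_scale -chart_add scaleN1r mulN1r.
apply: (le_trans (enorm_le_parts orthP _)).
rewrite base_part_chart// height_part_chart//.
have := graph_lipschitz xr yr; lra.
Qed.

(** This is the oscillation estimate at scale [enorm (x - y)], with an inner
    ball near the boundary point above [x]. *)
Lemma slope_holder x y : enorm x < rho / 2 -> enorm y < rho / 2 -> x != y ->
  enorm (sl x - sl y) <= 2 * C * (enorm (x - y)) `^ alpha.
Proof.
move=> xr2 yr2 xy.
have xr : enorm x < rho by have := enorm_ge0 x; lra.
have yr : enorm y < rho by have := enorm_ge0 y; lra.
have r0 : 0 < enorm (x - y).
  by rewrite lt_def enorm_ge0 enorm_eq0 subr_eq0 xy.
have rr : enorm (x - y) <= rho by have := enormB x y; lra.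
have [z zr zx] := inner_balls (graph_boundary xr) r0 rr.
apply: (le_trans (slope_dist_le orthP (graph_normal xr) (graph_normal yr))).
rewrite -mulrA ler_pM2l//; apply: (osc r0 zr).
- exact: graph_boundary.
- exact: graph_boundary.
- by rewrite enormC (le_trans zx)// ler_pM2r//; lra.
- apply: (le_trans (enorm_dist_trans (Phi x) _ _)).
  have := graph_dist xr yr; rewrite (enormC y) => h1.
  rewrite (enormC _ z); lra.
Qed.

Lemma slope_continuous x e : enorm x < rho / 2 -> 0 < e -> exists2 r, 0 < r &
  forall y, enorm (y - x) < r -> enorm y < rho / 2 /\ enorm (sl y - sl x) <= e.
Proof.
move=> xr e0.
have C20 : 0 <= 2 * C by rewrite mulr_ge0.
have [r r0 rP] := small_power alpha0 e0 C20.
exists (Num.min r (rho / 2 - enorm x)); first by rewrite lt_min r0 subr_gt0.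
move=> y; rewrite lt_min => /andP[yr yx].
have yr2 : enorm y < rho / 2.
  by have := enormD (y - x) x; rewrite subrK; lra.
split=> //; have [->|xy] := eqVneq y x; first by rewrite subrr enorm0 ltW.
apply: (le_trans (slope_holder yr2 xr xy)); apply: rP; last exact: ltW.
by rewrite lt_def enorm_ge0 enorm_eq0 subr_eq0 xy.
Qed.

(** The supporting hyperplanes at the two end points enclose the increment of
    [f], and their slopes are close to each other. *)
Lemma graph_is_derive x v : enorm x < rho / 2 ->
  is_derive x v f (edot v (sl x)).
Proof.
move=> xr.
have L : (fun h => h^-1 *: ((f \o shift x) (h *: v) - f x)) @ 0^' --> edot v (sl x).
  apply/cvgrPdist_le => e e0.
  have v1 : 0 < enorm v + 1 by rewrite ltr_wpDl ?enorm_ge0.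
  have [r r0 rP] := slope_continuous xr (divr_gt0 e0 v1).
  near=> h.
  have h0 : h != 0 by near: h; exact: nbhs_dnbhs_neq.
  have hr : `|h| < r / (enorm v + 1).
    near: h; apply: dnbhs0_lt; exact: divr_gt0.
  have hv : enorm ((h *: v + x) - x) < r.
    rewrite addrK enormZ; move: hr; rewrite ltr_pdivlMr//; apply: le_lt_trans.
    by rewrite ler_wpM2l// lerDl.
  have [yr sle] := rP _ hv; set y := h *: v + x in yr sle hv *.
  have rr2 : rho / 2 < rho by have := rho0; lra.
  have s1 := graph_support (lt_trans xr rr2) (lt_trans yr rr2).
  have s2 := graph_support (lt_trans yr rr2) (lt_trans xr rr2).
  have yx : y - x = h *: v by rewrite /y addrK.
  have xy : x - y = - (h *: v) by rewrite -yx opprB.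
  rewrite yx edotZl in s1; rewrite xy edotNl edotZl in s2.
  have d1 := edot_abs_le v (sl y - sl x); rewrite edotBr in d1.
  have d2 : enorm v * enorm (sl y - sl x) <= e.
    apply: (@le_trans _ _ ((enorm v + 1) * (e / (enorm v + 1)))).
      by rewrite ler_pM ?enorm_ge0// lerDl.
    by rewrite mulrC divfK// gt_eqF.
  apply: (quotient_between h0 s1 _ (le_trans d1 d2)).
  by rewrite -lerN2 opprB.
by apply: DeriveDef; [apply/cvg_ex; eexists; exact: L|exact: cvg_lim].
Unshelve. all: by end_near. Qed.

Lemma ball_domain (x : 'rV[R]_d) : eball 0 (rho / 2) x -> enorm x < rho / 2.
Proof. by rewrite /eball/= subr0. Qed.

Lemma edot_basis_vec i (u : 'rV[R]_d) : edot (basis_vec i) u = u 0 i.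
Proof.
rewrite /edot (bigD1 i)//= mxE !eqxx mul1r big1 ?addr0// => k ki.
by rewrite mxE (negbTE ki) andbF mul0r.
Qed.

Lemma graph_grad x : enorm x < rho / 2 -> grad f x = sl x.
Proof.
move=> xr; apply/rowP => i; rewrite mxE.
rewrite (@derive_val _ _ _ _ _ _ _ (graph_is_derive (basis_vec i) xr)).
exact: edot_basis_vec.
Qed.

Lemma graph_differentiable x : enorm x < rho / 2 -> differentiable f x.
Proof.
move=> xr.
have oB : open_nbhs x (eball 0 (rho / 2)).
  by split; [exact: eball_open|rewrite /eball/= subr0].
apply: (continuous_partials_differentiable oB _ _).1.
  move=> y i /ball_domain yr.
  exact: (@ex_derive _ _ _ _ _ _ _ (graph_is_derive (basis_vec i) yr)).
move=> i A /nbhs_ballP[e /= e0 eA].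
have [r r0 rP] := slope_continuous xr (divr_gt0 e0 (ltr0n R 2)).
apply/nbhs_eballP; exists r => // y /rP[yr sle]; apply: eA.
rewrite /ball/=.
have D z : enorm z < rho / 2 -> 'D_(basis_vec i) f z = sl z 0 i.
  move=> zr; rewrite (@derive_val _ _ _ _ _ _ _ (graph_is_derive (basis_vec i) zr)).
  exact: edot_basis_vec.
rewrite !D// distrC (le_lt_trans (coord_dist_le_enorm _ _ _))//.
by apply: (le_lt_trans sle); rewrite ltr_pdivrMr// ltr_pMr// ltr1n.
Qed.

Lemma graph_map_affine x :
  Phi x = x *m usubmx P^T + x0 + f x *: chart P 0 1.
Proof.
rewrite /Phi chart_split addrA (addrC x0); congr (_ + _ + _).
by rewrite /chart -{1}[P^T]vsubmxK mul_row_col raddf0 mul0mx addr0.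
Qed.

Lemma graph_map_differentiable x : enorm x < rho / 2 -> differentiable Phi x.
Proof.
move=> xr; have -> : Phi = fun x => x *m usubmx P^T + x0 + f x *: chart P 0 1.
  by apply/funext => y; exact: graph_map_affine.
apply: differentiableD; last exact: differentiableZl (graph_differentiable xr).
apply: differentiableD; last exact: differentiable_cst.
apply: (@linear_differentiable _ _ _ (mulmxr (usubmx P^T))).
exact: mulmx_continuous.
Qed.

Lemma graph_map_is_derive x i : enorm x < rho / 2 ->
  is_derive x (basis_vec i) Phi
    (basis_vec i *m usubmx P^T + sl x 0 i *: chart P 0 1).
Proof.
move=> xr; have -> : Phi = fun x => x *m usubmx P^T + x0 + f x *: chart P 0 1.
  by apply/funext => y; exact: graph_map_affine.
have dM := is_derive_mulmx (usubmx P^T) x (basis_vec i).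
have dx0 : is_derive x (basis_vec i) (cst x0 : 'rV[R]_d -> 'rV[R]_(d + 1)) 0.
  exact: is_derive_cst.
have df := graph_is_derive (basis_vec i) xr; rewrite edot_basis_vec in df.
have := is_deriveD (is_deriveD dM dx0) (is_derive_scalel (chart P 0 1) df).
by rewrite addr0.
Qed.

(** With [g] a local defining function, the slope is a rational function of
    [grad g \o Phi]: the partial derivatives of [f] and of [Phi] belong to the
    algebra [pullback]. *)
Lemma graph_smooth : smooth_on (eball 0 (rho / 2)) f.
Proof.
apply: smooth_on_local => x /ball_domain xr.
have rr2 : rho / 2 < rho by have := rho0; lra.
have SPhi y : enorm y < rho / 2 -> S (Phi y).
  by move=> yr; apply: graph_boundary; exact: lt_trans yr rr2.
have [g dg] := bd_smooth (SPhi x xr); have [U [[oU Ux] sg OU gU]] := dg.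
pose B := [set y | enorm y < rho / 2 /\ U (Phi y)].
exists B; first by [].
have oB : open B.
  rewrite openE => y [yr Uy].
  have nU : nbhs y (Phi @^-1` U).
    by apply: (differentiable_continuous (graph_map_differentiable yr)); exact: open_nbhs_nbhs.
  have nr : nbhs y (eball 0 (rho / 2)).
    by apply: open_nbhs_nbhs; split; [exact: eball_open|rewrite /eball/= subr0].
  apply: (@filterS _ (nbhs y) _ _ _ _ (filterI nr nU)) => u [/ball_domain ur Uu].
  by split.
pose gr y := grad g (Phi y).
have slE y : B y -> sl y = slope P (gr y).
  move=> [yr Uy]; have dgy : defining_function Omega (Phi y) g by exists U.
  rewrite /sl /nrm (outward_normalE body (SPhi y yr) dgy) slopeZ//.
  by rewrite invr_eq0 enorm_eq0 gU.
have pc := pullback_cst Phi B oU.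
have pgr k : pullback Phi B U (fun y => gr y 0 k).
  rewrite (_ : (fun y => _) = 'D_(basis_vec k) g \o Phi).
    exact: (pullback_comp _ _ (smooth_partial k sg)).
  by apply/funext => y; rewrite /gr mxE.
have pheight : pullback Phi B U (fun y => height_part P (gr y)).
  rewrite (_ : (fun y => _) = fun y => \sum_k gr y 0 k * chart P 0 1 0 k).
    by apply: pullback_sum => // k; apply: pullback_mul => //; exact: pc.
  by apply/funext => y; rewrite height_part_edot.
have pbase i : pullback Phi B U (fun y => base_part P (gr y) 0 i).
  rewrite (_ : (fun y => _) = fun y => \sum_k gr y 0 k * P k (lshift 1 i)).
    by apply: pullback_sum => // k; apply: pullback_mul => //; exact: pc.
  by apply/funext => y; rewrite /base_part !mxE.
have height_neq0 y : B y -> height_part P (gr y) != 0.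
  move=> [yr Uy]; have dgy : defining_function Omega (Phi y) g by exists U.
  have [h _] := near_axis orthP (graph_normal (lt_trans yr rr2)).
  move: h; rewrite /nrm (outward_normalE body (SPhi y yr) dgy) height_partZ.
  by move=> h; apply: contraTneq h => ->; rewrite mulr0 -ltNge divr_gt0.
have pslope i : pullback Phi B U (fun y => slope P (gr y) 0 i).
  rewrite (_ : (fun y => _) = fun y => (-1) * ((height_part P (gr y))^-1 *
      base_part P (gr y) 0 i)).
    apply: pullback_mul; first exact: pc.
    by apply: pullback_mul => //; exact: pullback_inv.
  by apply/funext => y; rewrite /slope !mxE mulN1r.
apply: (smooth_of_pullback_partials (Phi := Phi) (B := B) (dPhi := fun i y =>
    basis_vec i *m usubmx P^T + slope P (gr y) 0 i *: chart P 0 1) oU).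
- by move=> y [].
- by move=> y [yr _]; exact: graph_map_differentiable.
- move=> y i By; rewrite -(slE y By); exact: (graph_map_is_derive i By.1).
- move=> i k.
  rewrite (_ : (fun y => _) = fun y => (basis_vec i *m usubmx P^T) 0 k +
      slope P (gr y) 0 i * chart P 0 1 0 k).
    by apply: pullback_add; [exact: pc|apply: pullback_mul => //; exact: pc].
  by apply/funext => y; rewrite !mxE.
- exact: oB.
- by move=> y [yr _]; exact: differentiable_continuous (graph_differentiable yr).
- move=> i; exists (fun y => slope P (gr y) 0 i) => // y By.
  rewrite -(slE y By) -edot_basis_vec; exact: (graph_is_derive _ By.1).
Qed.

(** A boundary point strictly below the graph would have a normal pointing
    downwards, although it lies above the inner ball of [bottom_ball]. *)
Lemma graph_image : Phi @` eball 0 (rho / 2) = S `&`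
  [set v | enorm (base_part P (v - x0)) < rho / 2 /\
           - (5 / 2 * rho) < height_part P (v - x0)].
Proof.
have rr2 : rho / 2 < rho by have := rho0; lra.
apply/seteqP; split=> [_ [x /ball_domain xr <-]|v [Sv [vr hv]]].
  have xr' := lt_trans xr rr2.
  split; first exact: graph_boundary.
  rewrite /=; have -> : Phi x - x0 = chart P x (f x) by rewrite /Phi addrAC subrr add0r.
  rewrite base_part_chart// height_part_chart//; split=> //.
  have zr : enorm (0 : 'rV[R]_d) < rho by rewrite enorm0.
  have := graph_lipschitz zr xr'; rewrite graph0 !subr0 ler_norml => /andP[h _].
  have := rho0; lra.
set x := base_part P (v - x0) in vr; set h := height_part P (v - x0) in hv.
have vE : v = x0 + chart P x h by rewrite chart_parts// addrC subrK.
have xr := lt_trans vr rr2; have [Sx fmax] := fP (domain_lt xr).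
exists x; first by rewrite /eball/= subr0.
suff fE : f x = h by rewrite /Phi fE -vE.
apply/le_anti; rewrite fmax ?andbT; last first.
  by rewrite -vE; exact: (boundary_mem body).
rewrite leNgt; apply/negP => hf.
have r32 : 0 < 3 / 2 * rho by rewrite mulr_gt0.
have inw := inner_ball_support body bd_smooth bottom_ball Sv r32.
have supw := normal_supporting body bd_smooth Sv (boundary_mem body Sx).
rewrite -/nrm in inw supw.
have nu_le : edot (chart P 0 1) (nrm v) <= 0.
  have E : x0 + chart P x (f x) - v = (f x - h) *: chart P 0 1.
    rewrite {1}vE opprD addrACA subrr add0r (chart_split _ _ (f x)).
    by rewrite (chart_split _ _ h) opprD addrACA subrr add0r scalerBl.
  by move: supw; rewrite E edotZl pmulr_rle0 ?subr_gt0.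
have E : v - (x0 - (5 / 2 * rho) *: chart P 0 1) =
    chart P x 0 + (h + 5 / 2 * rho) *: chart P 0 1.
  have key (a b e : 'rV[R]_(d + 1)) (l m : R) :
      a + (b + l *: e) - (a - m *: e) = b + (l + m) *: e.
    by apply/rowP => i; rewrite !mxE; ring.
  by rewrite {1}vE chart_split key.
move: inw; rewrite E edotDl edotZl.
have h1 : (h + 5 / 2 * rho) * edot (chart P 0 1) (nrm v) <= 0.
  by rewrite mulr_ge0_le0//; lra.
have h2 : edot (chart P x 0) (nrm v) <= enorm x.
  rewrite (le_trans (edot_le _ _))// (enorm_normal body bd_smooth Sv) mulr1.
  by rewrite enorm_chart_base.
move=> h3; have := le_trans h3 (lerD h2 h1); rewrite leNgt addr0.
by rewrite domain_lt.
Qed.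

Lemma graph_parametrization :
  local_parametrization S x0 (eball 0 (rho / 2)) (rotated_graph x0 P f).
Proof.
have rr20 : 0 < rho / 2 by rewrite divr_gt0.
split.
- exists 0; first exact: eball_center.
  by rewrite /rotated_graph graph0 -/(chart P 0 0) chart0 addr0.
- exists [set v | enorm (base_part P (v - x0)) < rho / 2 /\
           - (5 / 2 * rho) < height_part P (v - x0)]; last exact: graph_image.
  rewrite openE => v [vr vh].
  have cb : {for v, continuous (fun v : 'rV[R]_(d + 1) => enorm (base_part P (v - x0)))}.
    apply: (@lipschitz_enorm_continuous _ _ _ 1) => y.
    rewrite mul1r (le_trans (enorm_lipschitz _ _))// -base_partB opprB addrA subrK.
    exact: enorm_base_part.
  have ch : {for v, continuous (fun v : 'rV[R]_(d + 1) => height_part P (v - x0))}.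
    apply: (@lipschitz_enorm_continuous _ _ _ 1) => y.
    rewrite mul1r -height_partB opprB addrA subrK.
    exact: height_part_le.
  have nb : nbhs v [set u | enorm (base_part P (u - x0)) < rho / 2].
    exact: (cb [set t | t < rho / 2] (lt_nbhsl vr)).
  have nh : nbhs v [set u | - (5 / 2 * rho) < height_part P (u - x0)].
    exact: (ch [set t | - (5 / 2 * rho) < t] (lt_nbhsr vh)).
  by apply: (@filterS _ (nbhs v) _ _ _ _ (filterI nb nh)) => u [].
split.
  rewrite (_ : rotated_graph x0 P f =
      fun x => x *m usubmx P^T + x0 + f x *: chart P 0 1); last first.
    by apply/funext => x; exact: graph_map_affine.
  apply: smooth_affine_graph; first exact: eball_open.
  exact: graph_smooth.
exists (fun v => base_part P (v - x0)); split.
  move=> x _; rewrite -/(Phi x) /Phi addrAC subrr add0r.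
  exact: base_part_chart.
move=> v _; exists setT, (fun v => base_part P (v - x0)); split=> //.
  by split; [exact: openT|].
rewrite (_ : (fun v => _) = fun v : 'rV[R]_(d + 1) =>
    v *m lsubmx P + (- base_part P x0) + 0 *: 0); last first.
  apply/funext => u; rewrite base_partB scaler0 addr0; congr (_ + _).
  by rewrite /base_part mulmx_lsub.
apply: smooth_affine_graph; first exact: openT.
exact: smooth_cst openT.
Qed.

End ConvexGraph.

(** * Uniform graphs for bodies of bounded energy *)

Theorem theorem1p1 (R : realType) (d : nat) (s p c : R) :
  (1 <= d)%N -> 0 < s -> s < 1 -> d%:R / s < p -> 0 < c ->
  forall Lambda : R, 0 < Lambda ->
  exists r C : R, 0 < r /\
    forall Omega : set 'rV[R]_(d + 1),
      convex_body Omega -> smooth_boundary Omega ->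
      (fractional_willmore c s p Omega <= Lambda%:E)%E ->
      forall x0 : 'rV[R]_(d + 1), boundary Omega x0 ->
      exists (P : 'M[R]_(d + 1)) (f : 'rV[R]_d -> R),
        [/\ special_orthogonal P,
            smooth_on (eball 0 r) f,
            (holder_seminorm (s - d%:R / p) (eball 0 r) (grad f) <= C%:E)%E &
            local_parametrization (boundary Omega) x0 (eball 0 r)
              (rotated_graph x0 P f)].
Proof.
move=> d0 s0 _ dsp c0 Lambda Lambda0.
have p0 : 0 < p by apply: le_lt_trans dsp; rewrite divr_ge0// ltW.
have alpha0 : 0 < s - d%:R / p.
  by rewrite subr_gt0 ltr_pdivrMr// mulrC -ltr_pdivrMr.
pose C := @oscillation_constant R d c s p Lambda.
have C0 : 0 <= C by exact: oscillation_constant_ge0.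
have e80 : 0 < 8^-1 :> R by rewrite invr_gt0.
have [rho rho0 scale] := small_power alpha0 e80 C0.
exists (rho / 2), (2 * C); split; first by rewrite divr_gt0.
move=> Omega body bd_smooth energy x0 Sx0.
have osc z w1 w2 r : 0 < r -> eball z r `<=` Omega -> boundary Omega w1 ->
    boundary Omega w2 -> enorm (w1 - z) <= 8 * r -> enorm (w2 - z) <= 8 * r ->
    enorm (outward_normal Omega w1 - outward_normal Omega w2)
      <= C * r `^ (s - d%:R / p).
  exact: normal_oscillation.
have [P oP PE] := rotation_to_axis d0 (enorm_normal body bd_smooth Sx0).
have orthP := oP.1.
have [f fP] := graph_function_exists body bd_smooth rho0 osc scale Sx0 orthP PE.
exists P, f; split=> //.
- exact: (graph_smooth body bd_smooth C0 alpha0 rho0 osc scale Sx0 orthP PE fP).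
- apply: ge_ereal_sup => _ [[x y] /= [/ball_domain xr /ball_domain yr xy] <-].
  rewrite lee_fin.
  rewrite !(graph_grad body bd_smooth C0 alpha0 rho0 osc scale Sx0 orthP PE fP)//.
  have xy0 : 0 < enorm (x - y).
    by rewrite lt_def enorm_ge0 enorm_eq0 subr_eq0 andbT; apply/eqP.
  rewrite ler_pdivrMr ?powR_gt0//.
  apply: (slope_holder body bd_smooth rho0 osc scale Sx0 orthP PE fP) => //.
  exact/eqP.
- exact: (graph_parametrization body bd_smooth C0 alpha0 rho0 osc scale Sx0 orthP PE fP).
Qed.
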